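(* Let $k$ be a field, let $G$ be an affine group scheme over $k$ and let $X$ be an affine $G$-torsor. Then $X$ can be written as a projective limit $X=\varprojlim_{i\in I} X_i$ of affine $G$-spaces $X_i$ of finite type over $k$ such that every $X_i$ is a $G/C_G(X_i)$-torsor.
   Context: All schemes, group schemes, products and morphisms are over the field $k$ (arbitrary). A $G$-space is a scheme $X$ together with a right action $X\times G\to X,\ (x,g)\mapsto x.g$, of $G$; a morphism of $G$-spaces is a $G$-equivariant morphism of schemes. A $G$-torsor is a non-empty $G$-space $X$ such that $X\times G\to X\times X,\ (x,g)\mapsto (x,x.g)$ is an isomorphism. For an affine $G$-space $X$ the centralizer $C_G(X)$ is defined, for every $k$-algebra $R$, by $$C_G(X)(R)=\{g\in G(R)\mid x.g=x \text{ for all } x\in X(R') \text{ and all } R\text{-algebras } R'\}.$$ It is a normal closed subgroup scheme of $G$, and the $G$-action on $X$ induces an action of the quotient affine group scheme $G/C_G(X)$ on $X$; this is the action with respect to which ''$X$ is a $G/C_G(X)$-torsor'' is understood. A projective limit is taken over a directed index set $I$, in the category of $G$-spaces (so the transition morphisms $X_j\to X_i$, $i\leq j$, and the projections $X\to X_i$ are $G$-equivariant). *)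

(* Defs.v *)
From HB Require Import structures.
From mathcomp Require Import all_boot all_order all_algebra.
From mathcomp Require Import boolp.
From mathcomp Require Import mpoly.

Set Implicit Arguments.
Unset Strict Implicit.
Unset Printing Implicit Defensive.

Import GRing.Theory.
Local Open Scope ring_scope.

(* Schemes over k are handled through their functors of points.  An affine   *)
(* scheme is given by its coordinate ring A; its R-points are the k-algebra   *)
(* morphisms A -> R.  By the Yoneda lemma a morphism of schemes is a natural  *)
(* transformation, and it is an isomorphism iff it is bijective on R-points   *)
(* for every R.  In MathComp a [comAlgType k] is a nonzero commutative        *)
(* algebra; the zero ring has exactly one point in every scheme, so leaving   *)
(* it out loses nothing, except that the empty scheme is not of the form      *)
(* [Spec A] (torsors are non-empty anyway).                                   *)

Lemma lrmorphism_ext (k : fieldType) (A B : comAlgType k)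
  (f g : {lrmorphism A -> B}) : f =1 g -> f = g.
Proof.
case: f g => f [[f1] [f2] [f3]] [g [[g1] [g2] [g3]]] /= fg.
have {fg} E : f = g by apply: funext.
case: g / E g1 g2 g3 => g1 g2 g3.
by rewrite (Prop_irrelevance f1 g1) (Prop_irrelevance f2 g2)
  (Prop_irrelevance f3 g3).
Qed.

Section Schemes.
Variable k : fieldType.

(* [kfunctor] contains the category of k-schemes as a full subcategory *)
Record kfunctor := KFunctor {
  pts :> comAlgType k -> Type;
  pmap : forall R S : comAlgType k, {lrmorphism R -> S} -> pts R -> pts S;
  pmap_id : forall (R : comAlgType k) (x : pts R),
    pmap (idfun : {lrmorphism R -> R}) x = x;
  pmap_comp : forall (R S T : comAlgType k)
      (g : {lrmorphism S -> T}) (f : {lrmorphism R -> S}) (x : pts R),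
    pmap (g \o f : {lrmorphism R -> T}) x = pmap g (pmap f x)
}.

Section Spec.
Variable A : comAlgType k.

Definition spec_pts (R : comAlgType k) : Type := {lrmorphism A -> R}.

Definition spec_map (R S : comAlgType k) (f : {lrmorphism R -> S})
  (x : spec_pts R) : spec_pts S := (f \o x : {lrmorphism A -> S}).

Lemma spec_map_id (R : comAlgType k) (x : spec_pts R) :
  spec_map (idfun : {lrmorphism R -> R}) x = x.
Proof. by apply: lrmorphism_ext. Qed.

Lemma spec_map_comp (R S T : comAlgType k)
    (g : {lrmorphism S -> T}) (f : {lrmorphism R -> S}) (x : spec_pts R) :
  spec_map (g \o f : {lrmorphism R -> T}) x = spec_map g (spec_map f x).
Proof. by apply: lrmorphism_ext. Qed.

Definition Spec : kfunctor := KFunctor spec_map_id spec_map_comp.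

End Spec.

Definition spec_hom (A B : comAlgType k) (phi : {lrmorphism B -> A})
  (R : comAlgType k) (x : Spec A R) : Spec B R :=
  (x \o phi : {lrmorphism B -> R}).

Definition finitely_generated (A : comAlgType k) : Prop :=
  exists (n : nat) (f : {lrmorphism {mpoly k[n]} -> A}),
    forall a : A, exists p : {mpoly k[n]}, f p = a.

Record affGroup := AffGroup {
  gring : comAlgType k;
  gmul : forall R : comAlgType k,
    Spec gring R -> Spec gring R -> Spec gring R;
  gone : forall R : comAlgType k, Spec gring R;
  ginv : forall R : comAlgType k, Spec gring R -> Spec gring R;
  gmulA : forall (R : comAlgType k) (x y z : Spec gring R),
    gmul x (gmul y z) = gmul (gmul x y) z;
  gmul1g : forall (R : comAlgType k) (x : Spec gring R), gmul (gone R) x = x;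
  gmulVg : forall (R : comAlgType k) (x : Spec gring R),
    gmul (ginv x) x = gone R;
  gmul_nat : forall (R S : comAlgType k) (f : {lrmorphism R -> S})
      (x y : Spec gring R),
    pmap f (gmul x y) = gmul (pmap f x) (pmap f y)
}.

Definition gpts (G : affGroup) : kfunctor := Spec (gring G).

Section GSpaces.
Variable G : affGroup.

Record action (X : kfunctor) := Action {
  act :> forall R : comAlgType k, X R -> gpts G R -> X R;
  act1 : forall (R : comAlgType k) (x : X R), act x (gone G R) = x;
  actM : forall (R : comAlgType k) (x : X R) (g h : gpts G R),
    act x (gmul g h) = act (act x g) h;
  act_nat : forall (R S : comAlgType k) (f : {lrmorphism R -> S})
      (x : X R) (g : gpts G R),
    pmap f (act x g) = act (pmap f x) (pmap f g)
}.

Record gspace := GSpace { gsp :> kfunctor; gact : action gsp }.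

Record gmorph (X Y : gspace) := GMorph {
  gmor :> forall R : comAlgType k, X R -> Y R;
  gmor_nat : forall (R S : comAlgType k) (f : {lrmorphism R -> S}) (x : X R),
    pmap f (gmor x) = gmor (pmap f x);
  gmor_act : forall (R : comAlgType k) (x : X R) (g : gpts G R),
    gmor (gact X R x g) = gact Y R (gmor x) g
}.

Record affSpace := AffSpace { oring : comAlgType k; oact : action (Spec oring) }.

Definition gspace_of_aff (X : affSpace) : gspace := GSpace (oact X).
Coercion gspace_of_aff : affSpace >-> gspace.

Definition is_torsor (X : kfunctor) (a : action X) : Prop :=
  (exists R : comAlgType k, inhabited (X R)) /\
  forall R : comAlgType k,
    bijective (fun xg : X R * gpts G R => (xg.1, a R xg.1 xg.2)).

(* The subfunctor C_G(X) of G; the R-algebras are the k-algebras R' together *)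
(* with a morphism of k-algebras R -> R'.                                    *)
Definition centralizer (X : gspace) (R : comAlgType k) (g : gpts G R) : Prop :=
  forall (R' : comAlgType k) (f : {lrmorphism R -> R'}) (x : X R'),
    gact X R' x (pmap f g) = x.

End GSpaces.

Definition is_ghom (G Q : affGroup) (phi : {lrmorphism gring Q -> gring G}) :
  Prop :=
  forall (R : comAlgType k) (g h : gpts G R),
    spec_hom phi (gmul g h) = gmul (spec_hom phi g) (spec_hom phi h).

(* (Q, pi) is the quotient affine group scheme G/N, where pi : G -> Q has      *)
(* comorphism phi: over a field, a quotient map of affine group schemes is a   *)
(* homomorphism with injective comorphism, and G/N is the target of a quotient *)
(* map with kernel N (Waterhouse, Introduction to Affine Group Schemes,        *)
(* chapters 15 and 16).  It is unique up to unique isomorphism.                *)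
Definition is_quotient (G Q : affGroup) (phi : {lrmorphism gring Q -> gring G})
  (N : forall R : comAlgType k, gpts G R -> Prop) : Prop :=
  [/\ is_ghom phi,
      injective phi
    & forall (R : comAlgType k) (g : gpts G R),
        spec_hom phi g = gone Q R <-> N R g].

(* X is a G/C_G(X)-torsor for the action b of G/C_G(X) induced by that of G *)
Definition torsor_mod_centralizer (G : affGroup) (X : gspace G) : Prop :=
  exists (Q : affGroup) (phi : {lrmorphism gring Q -> gring G})
         (b : action Q X),
    [/\ is_quotient phi (@centralizer G X),
        forall (R : comAlgType k) (x : X R) (g : gpts G R),
          b R x (spec_hom phi g) = gact X R x g
      & is_torsor b].

Record directedSet := DirectedSet {
  idx :> Type;
  dle : idx -> idx -> Prop;
  dle_refl : forall i, dle i i;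
  dle_trans : forall i j l, dle i j -> dle j l -> dle i l;
  dle_directed : forall i j, exists l, dle i l /\ dle j l;
  idx_inhabited : inhabited idx
}.

Section Limits.
Variables (G : affGroup) (I : directedSet) (X_ : I -> gspace G).

Record transition := Transition {
  tmap :> forall i j : I, dle i j -> gmorph (X_ j) (X_ i);
  tmap_id : forall (i : I) (h : dle i i) (R : comAlgType k) (x : X_ i R),
    tmap h R x = x;
  tmap_comp : forall (i j l : I) (hij : dle i j) (hjl : dle j l) (hil : dle i l)
      (R : comAlgType k) (x : X_ l R),
    tmap hij R (tmap hjl R x) = tmap hil R x
}.

Definition is_cone (t : transition) (Y : gspace G)
  (q : forall i : I, gmorph Y (X_ i)) : Prop :=
  forall (i j : I) (h : dle i j) (R : comAlgType k) (y : Y R),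
    t i j h R (q j R y) = q i R y.

(* The universal property is required against all k-functors Y with a right  *)
(* G-action, hence in particular against all schemes with a right G-action.  *)
Definition is_limit (t : transition) (X : gspace G)
  (p : forall i : I, gmorph X (X_ i)) : Prop :=
  is_cone t p /\
  forall (Y : gspace G) (q : forall i : I, gmorph Y (X_ i)), is_cone t q ->
    exists u : gmorph Y X,
      (forall (i : I) (R : comAlgType k) (y : Y R), p i R (u R y) = q i R y) /\
      forall v : gmorph Y X,
        (forall (i : I) (R : comAlgType k) (y : Y R), p i R (v R y) = q i R y) ->
        forall (R : comAlgType k) (y : Y R), v R y = u R y.

End Limits.
End Schemes.

(* Main.v *)
Require Import Defs.
From HB Require Import structures.
From mathcomp Require Import all_boot all_order all_algebra.
From mathcomp Require Import boolp classical_sets mpoly.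

(** Let H and A be the coordinate rings of G and X, with comultiplication
    Delta, antipode S and coaction rho : A -> A (x) H.  Since X is a torsor, the
    universal pair of points of X, over A (x) A, is joined by a unique point of
    G, the translation map tau : H -> A (x) A: two points x, y of X over R
    satisfy x.tau(x, y) = y.

    The index set consists of the finitely generated Hopf subalgebras P of H;
    every finite part of H lies in one of them ([fg_hopf_subalgebra]), because
    the matrix coefficients of an element span a finite-dimensional
    subcoalgebra.  The stage attached to P is Spec A_P, where A_P is the
    algebra of those u with rho u in A (x) P: it is the quotient of X by the
    kernel of G -> Spec P.

    Coassociativity gives rho(A_P) in A_P (x) P ([invariants_coact]), so Spec P
    acts on Spec A_P.  Moreover tau(P) lies in A_P (x) A_P
    ([invariants_translation]): the rule tau(x, y.g) = tau(x, y) g controls the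
    second factor, and tau(y, x) = tau(x, y)^-1 exchanges the factors.  The
    restriction of tau to P then inverts (x, g) |-> (x, x.g) over Spec A_P, so
    that Spec A_P is a torsor under Spec P ([quotient_torsor]) without any
    recourse to descent.  The action of Spec P being free, the kernel of
    G -> Spec P is the centralizer of Spec A_P ([quotient_kernel]).

    If P is generated by h_1, .., h_n, let B be the algebra generated by the
    components of tau(h_1), .., tau(h_n).  Reading y = x.tau(x, y) on a function
    u in A_P gives 1 (x) u in A (x) B, hence u in B, and A_P = B is of finite
    type ([invariants_fg]).  Finally rho u involves finitely many elements of
    H, so A is the directed union of the A_P ([invariants_cover]), and its
    spectrum is the limit of the Spec A_P ([stage_limit]).

    Two devices replace flatness.  A tensor lies in A' (x) B' as soon as its
    slices by linear forms on either factor lie in A' and in B'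
    ([in_tens_expand]).  A point of Spec A_P or Spec P over R need not extend
    to A or H, but an identity between such points can be checked on universal
    points, whose ring is embedded in a ring over which they do extend
    ([universal_points]). *)

Set Implicit Arguments.
Unset Strict Implicit.
Unset Printing Implicit Defensive.

Import GRing.Theory.
Local Open Scope ring_scope.
Local Open Scope quotient_scope.

(** * Linear forms and dual bases *)

Section LinearForms.
Variables (k : fieldType) (V : lmodType k).

Definition subspace (W : V -> Prop) : Prop :=
  W 0 /\ forall (c : k) u v, W u -> W v -> W (c *: u + v).

Lemma subspace_sum (W : V -> Prop) (I : Type) (s : seq I) (c : I -> k)
    (v : I -> V) :
  subspace W -> (forall i, W (v i)) -> W (\sum_(i <- s) c i *: v i).
Proof.
by move=> [W0 WD] Wv; elim/big_rec: _ => // i x _ Wx; apply: WD.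
Qed.

(** A subspace [W] maximal among those avoiding [r] is a complement of the line
    spanned by [r]; the form is the coordinate along [r]. *)
Lemma linear_form_eq1 (r : V) :
  r != 0 -> exists lam : {linear V -> k^o}, lam r = 1.
Proof.
move=> r0.
(* [P] does not require [W 0], so that the union of the empty chain has [P] *)
pose P (W : set V) := (forall (c : k) u v, W u -> W v -> W (c *: u + v)) /\ ~ W r.
have [F FP Ft|W [[WD Wr] maxW]] := @Zorn_bigcup V P.
  split=> [c u v [X FX Xu] [Y FY Yv]|[X FX]]; last by case: (FP _ FX).
  have [XY|YX] := Ft X Y FX FY.
    by exists Y => //; apply: (FP _ FY).1 => //; apply: XY.
  by exists X => //; apply: (FP _ FX).1 => //; apply: YX.
(* an empty [W] could be enlarged to the zero subspace *)
have W0 : W 0.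
  apply: contrapT => nW0.
  have Wn v : ~ W v.
    by move=> Wv; apply: nW0; rewrite -(addNr v) -scaleN1r; apply: WD.
  apply: (maxW (fun v : V => v = 0)).
    by split=> [v /Wn //|/(_ 0 erefl)].
  by split=> [c u v -> ->|/eqP]; rewrite ?scaler0 ?addr0 // (negbTE r0).
have WZ (c : k) u : W u -> W (c *: u).
  by move=> Wu; rewrite -[_ *: _]addr0; apply: WD.
have WB (u v : V) : W u -> W v -> W (u - v).
  by move=> Wu Wv; rewrite addrC -scaleN1r; apply: WD.
(* otherwise [W] plus the line of [x] would still avoid [r] *)
have ex x : exists c : k, W (x - c *: r).
  apply: contrapT => nex.
  pose W' : set V := fun v => exists c : k, W (v - c *: x).
  apply: (maxW W').
    split; first by move=> v Wv; exists 0; rewrite scale0r subr0.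
    move=> /(_ x) WW'; apply: nex; exists 0; rewrite scale0r subr0; apply: WW'.
    by exists 1; rewrite scale1r subrr.
  split=> [c u v [a Wa] [b Wb]|[c Wc]].
    exists (c * a + b); rewrite scalerDl opprD addrACA -scalerA -scalerBr.
    exact: WD.
  have [c0|c0] := eqVneq c 0; first by rewrite c0 scale0r subr0 in Wc.
  apply: nex; exists c^-1.
  have -> : x - c^-1 *: r = (- c^-1) *: (r - c *: x).
    by rewrite scalerBr scalerA mulNr mulVf // !scaleNr scale1r opprK addrC.
  exact: WZ.
have /choice[f fW] := ex.
have uniqf x c : W (x - c *: r) -> f x = c.
  move=> Wc; apply/eqP; rewrite -subr_eq0; apply: contrapT => /negP ne.
  apply: Wr; rewrite -[r]scale1r -(mulVf ne) -scalerA; apply: WZ.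
  have -> : (f x - c) *: r = (x - c *: r) - (x - f x *: r).
    by rewrite scalerBl opprD addrACA subrr add0r opprK addrC.
  exact: WB.
have flin : linear (f : V -> k^o).
  move=> c u v; apply: uniqf.
  rewrite scalerDl opprD addrACA -scalerA -scalerBr; exact: WD.
pose lam := HB.pack_for {linear V -> k^o} (f : V -> k^o)
  (GRing.isLinear.Build k V k^o *:%R f flin).
exists lam; apply: uniqf; by rewrite scale1r subrr.
Qed.

(** The identity of a finite-dimensional space is a sum of rank one maps.  The
    subspace [W] serves to choose the [e i] inside a given subspace. *)
Lemma dual_basis (W : V -> Prop) (s : seq V) :
  subspace W -> (forall v, v \in s -> W v) ->
  exists (n : nat) (lam : nat -> {linear V -> k^o}) (e : nat -> V),
    (forall v, v \in s -> v = \sum_(i < n) (lam i v : k) *: e i) /\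
    (forall i, W (e i)).
Proof.
move=> subW; have [W0 WD] := subW; elim: s => [|a s IHs] Ws.
  by exists 0%N, (fun=> \0), (fun=> 0).
have [|n [lam [e [lamE We]]]] := IHs.
  by move=> v vs; apply: Ws; rewrite inE vs orbT.
(* [proj] kills the vectors already treated, hence so does the new form
   [mu \o proj], and [proj a] is the new basis vector *)
pose proj v := v - \sum_(i < n) (lam i v : k) *: e i.
have proj_lin : linear proj.
  move=> c u v; rewrite /proj scalerBr addrACA -opprD; congr (_ - _).
  rewrite scaler_sumr -big_split /=; apply: eq_bigr => i _.
  by rewrite linearP scalerDl scalerA.
have [r0|r0] := eqVneq (proj a) 0.
  exists n, lam, e; split=> // v; rewrite inE => /predU1P[->|]; last exact: lamE.
  by apply/eqP; rewrite -subr_eq0; apply/eqP.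
have [mu mu1] := linear_form_eq1 r0.
have flin : linear (mu \o proj : V -> k^o).
  by move=> c u v; rewrite /= proj_lin linearP.
pose lam' := HB.pack_for {linear V -> k^o} (mu \o proj : V -> k^o)
  (GRing.isLinear.Build k V k^o *:%R _ flin).
have lam'E v : lam' v = mu (proj v) by [].
exists n.+1, (fun i => if i == n then lam' else lam i),
  (fun i => if i == n then proj a else e i).
split=> [v|i]; last first.
  case: eqP => // _; rewrite /proj addrC -scaleN1r; apply: WD.
    exact: subspace_sum.
  by apply: Ws; rewrite mem_head.
rewrite inE big_ord_recr /= eqxx lam'E.
under eq_bigr => i _ do rewrite (ltn_eqF (ltn_ord i)).
case/predU1P => [->|vs]; first by rewrite mu1 scale1r addrC subrK.
by rewrite /proj -lamE // subrr linear0 scale0r addr0.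
Qed.

Lemma subspace_sum_ord (W : V -> Prop) (n : nat) (v : 'I_n -> V) :
  subspace W -> (forall i, W (v i)) -> W (\sum_(i < n) v i).
Proof.
move=> subW Wv; under eq_bigr => i _ do rewrite -[v i]scale1r.
exact: subspace_sum.
Qed.
End LinearForms.

(** * The tensor product of two commutative algebras *)

Section Tensor.
Variables (k : fieldType) (A B : comAlgType k).

Definition bilin (V : lmodType k) (F : A -> B -> V) : Prop :=
  (forall b, linear (F^~ b)) /\ (forall a, linear (F a)).

Definition pair_sum (V : lmodType k) (F : A -> B -> V) (s : seq (A * B)) : V :=
  \sum_(p <- s) F p.1 p.2.

(** Formal sums of pairs are identified when no bilinear map tells them apart.
    The universal property is then built in, and products are well defined
    because F (a * -) (b * -) is bilinear whenever F is. *)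
Definition same_tensor (s t : seq (A * B)) : bool :=
  `[< forall (V : lmodType k) (F : A -> B -> V), bilin F ->
        pair_sum F s = pair_sum F t >].

Lemma same_tensor_refl : reflexive same_tensor.
Proof. by move=> s; apply/asboolP. Qed.

Lemma same_tensor_sym s t : same_tensor s t = same_tensor t s.
Proof. by apply/asboolP/asboolP => e V F bF; rewrite e. Qed.

Lemma same_tensor_trans : transitive same_tensor.
Proof.
move=> t s u /asboolP st /asboolP tu.
by apply/asboolP => V F bF; rewrite st // tu.
Qed.

Canonical same_tensor_equiv :=
  EquivRel same_tensor same_tensor_refl same_tensor_sym same_tensor_trans.

Definition tens := {eq_quot same_tensor_equiv}.
HB.instance Definition _ := Choice.on tens.
HB.instance Definition _ := EqQuotient.on tens.

(** For a bilinear [F] this is the induced linear map; for other [F] it depends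
    on the chosen representatives. *)
Definition tlift (V : lmodType k) (F : A -> B -> V) (t : tens) : V :=
  pair_sum F (repr t).

Definition tclass (s : seq (A * B)) : tens := \pi_tens s.

Lemma tlift_pi (V : lmodType k) (F : A -> B -> V) s :
  bilin F -> tlift F (tclass s) = pair_sum F s.
Proof.
move=> bF; rewrite /tlift /tclass; case: piP => t /eqmodP /asboolP.
by move=> /(_ V F bF).
Qed.

Lemma tens_eq (t u : tens) :
  (forall (V : lmodType k) (F : A -> B -> V), bilin F -> tlift F t = tlift F u) ->
  t = u.
Proof.
move=> e; rewrite -[t]reprK -[u]reprK; apply/eqmodP/asboolP => V F bF.
exact: e.
Qed.

Lemma bilin_transl (V : lmodType k) (F : A -> B -> V) a b :
  bilin F -> bilin (fun x y => F (a * x) (b * y)).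
Proof.
case=> Fl Fr; split=> [y|x] c u v /=; first by rewrite mulrDr -scalerAr Fl.
by rewrite mulrDr -scalerAr Fr.
Qed.

Lemma bilin_mul (V : lmodType k) (F : A -> B -> V) a b :
  bilin F -> bilin (fun x y => F (x * a) (y * b)).
Proof.
case=> Fl Fr; split=> [y|x] c u v /=; first by rewrite mulrDl -scalerAl Fl.
by rewrite mulrDl -scalerAl Fr.
Qed.

Definition tadd (t u : tens) := tclass (repr t ++ repr u).
Definition tscale (c : k) (t : tens) := tclass [seq (c *: p.1, p.2) | p <- repr t].
Definition tmul (t u : tens) :=
  tclass [seq (p.1 * q.1, p.2 * q.2) | p <- repr t, q <- repr u].
Definition tzero := tclass [::].
Definition tone := tclass [:: (1, 1)].

Section Tev.
Variables (V : lmodType k) (F : A -> B -> V).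
Hypothesis bF : bilin F.

Lemma tliftD t u : tlift F (tadd t u) = tlift F t + tlift F u.
Proof. by rewrite tlift_pi // /pair_sum big_cat. Qed.

Lemma tliftZ c t : tlift F (tscale c t) = c *: tlift F t.
Proof.
rewrite tlift_pi // /pair_sum big_map scaler_sumr; apply: eq_bigr => p _ /=.
exact: (GRing.scalable_linear (bF.1 p.2)).
Qed.

Lemma tlift0 : tlift F tzero = 0.
Proof. by rewrite tlift_pi // /pair_sum big_nil. Qed.

Lemma tlift1 : tlift F tone = F 1 1.
Proof. by rewrite tlift_pi // /pair_sum big_seq1. Qed.

Lemma tliftM t u : tlift F (tmul t u) =
  tlift (fun a b => tlift (fun a' b' => F (a * a') (b * b')) u) t.
Proof.
rewrite tlift_pi // /tlift /pair_sum big_allpairs_dep /=.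
by apply: eq_bigr => p _.
Qed.

End Tev.

Lemma tlift_ext (V : lmodType k) (F F' : A -> B -> V) t :
  (forall a b, F a b = F' a b) -> tlift F t = tlift F' t.
Proof. by move=> e; apply: eq_bigr => p _; apply: e. Qed.

Lemma tlift_exch (V : lmodType k) (F : A -> B -> A -> B -> V) t u :
  tlift (fun a b => tlift (F a b) u) t = tlift (fun a b => tlift (fun a' b' => F a' b' a b) t) u.
Proof. by rewrite /tlift /pair_sum exchange_big. Qed.

Lemma bilin_tlift (V : lmodType k) (F : A -> B -> A -> B -> V) u :
  (forall a b, bilin (fun x y => F x y a b)) -> bilin (fun x y => tlift (F x y) u).
Proof.
move=> bF; split=> [y|x] c v w; rewrite /= /tlift /pair_sum scaler_sumr -big_split /=.
  by apply: eq_bigr => p _; have [+ _] := bF p.1 p.2; apply.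
by apply: eq_bigr => p _; have [_ +] := bF p.1 p.2; apply.
Qed.

Definition topp t := tscale (-1) t.

Lemma taddA : associative tadd.
Proof. by move=> t u v; apply: tens_eq => V F bF; rewrite !tliftD // addrA. Qed.
Lemma taddC : commutative tadd.
Proof. by move=> t u; apply: tens_eq => V F bF; rewrite !tliftD // addrC. Qed.
Lemma tadd0 : left_id tzero tadd.
Proof. by move=> t; apply: tens_eq => V F bF; rewrite !tliftD // tlift0 // add0r. Qed.
Lemma taddN : left_inverse tzero topp tadd.
Proof.
move=> t; apply: tens_eq => V F bF.
by rewrite !tliftD // tlift0 // tliftZ // scaleN1r addNr.
Qed.
HB.instance Definition _ := GRing.isZmodule.Build tens taddA taddC tadd0 taddN.

Lemma tmulA : associative tmul.
Proof.
move=> t u v; apply: tens_eq => V F bF; rewrite !tliftM //.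
  apply: tlift_ext => a b; rewrite tliftM; last exact: bilin_transl.
  by apply: tlift_ext => a' b'; apply: tlift_ext => a'' b''; rewrite !mulrA.
by apply: bilin_tlift => a b; apply: bilin_mul.
Qed.

Lemma tmulC : commutative tmul.
Proof.
move=> t u; apply: tens_eq => V F bF; rewrite !tliftM // tlift_exch.
by apply: tlift_ext => a b; apply: tlift_ext => a' b'; rewrite mulrC [b' * _]mulrC.
Qed.

Lemma tmul1 : left_id tone tmul.
Proof.
move=> t; apply: tens_eq => V F bF; rewrite tliftM // tlift1.
  by apply: tlift_ext => a b; rewrite !mul1r.
by apply: bilin_tlift => a b; apply: bilin_mul.
Qed.

Lemma tmulDl : left_distributive tmul tadd.
Proof.
move=> t u v; apply: tens_eq => V F bF.
by rewrite tliftM // !tliftD // ?tliftM //; apply: bilin_tlift => a b; apply: bilin_mul.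
Qed.

(** A form with value 1 at 1 separates 1 (x) 1 from 0. *)
Lemma tone_neq0 : tone != 0.
Proof.
have [lam lam1] := linear_form_eq1 (oner_neq0 A).
apply/eqP => e.
pose F (a : A) (b : B) : B := (lam a : k) *: b.
have bF : bilin F.
  split=> [y|x] c u v; rewrite /F ?linearP /=.
    by rewrite scalerDl scalerA.
  by rewrite !scalerA mulrC.
have := tlift1 bF; rewrite e tlift0 // /F lam1 scale1r => /esym/eqP.
by rewrite oner_eq0.
Qed.

HB.instance Definition _ :=
  GRing.Zmodule_isComNzRing.Build tens tmulA tmulC tmul1 tmulDl tone_neq0.

Lemma tscaleA a b t : tscale a (tscale b t) = tscale (a * b) t.
Proof. by apply: tens_eq => V F bF; rewrite !tliftZ // scalerA. Qed.
Lemma tscale1 : left_id 1 tscale.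
Proof. by move=> t; apply: tens_eq => V F bF; rewrite !tliftZ // scale1r. Qed.
Lemma tscaleDr : right_distributive tscale +%R.
Proof.
move=> c t u; apply: tens_eq => V F bF.
by rewrite tliftZ // !tliftD // !tliftZ // scalerDr.
Qed.
Lemma tscaleDl t : {morph tscale^~ t : a b / a + b}.
Proof.
move=> a b; apply: tens_eq => V F bF.
by rewrite tliftZ // tliftD // !tliftZ // scalerDl.
Qed.
HB.instance Definition _ :=
  GRing.Zmodule_isLmodule.Build k tens tscaleA tscale1 tscaleDr tscaleDl.

Lemma tscaleAl c (t u : tens) : c *: (t * u) = (c *: t) * u.
Proof.
apply: tens_eq => V F bF; rewrite tliftZ // !tliftM // tliftZ //.
by apply: bilin_tlift => a b; apply: bilin_mul.
Qed.
HB.instance Definition _ := GRing.Lmodule_isLalgebra.Build k tens tscaleAl.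

Lemma tscaleAr c (t u : tens) : c *: (t * u) = t * (c *: u).
Proof. by rewrite mulrC scalerAl mulrC. Qed.
HB.instance Definition _ := GRing.Lalgebra_isAlgebra.Build k tens tscaleAr.

End Tensor.

(** * Pure tensors, morphisms and slices *)

Section TensorMaps.
Variables (k : fieldType) (A B : comAlgType k).
Implicit Types (t : tens A B).

Definition tpure (a : A) (b : B) : tens A B := tclass [:: (a, b)].

Lemma tlift_pure (V : lmodType k) (F : A -> B -> V) a b :
  bilin F -> tlift F (tpure a b) = F a b.
Proof. by move=> bF; rewrite tlift_pi // /pair_sum big_seq1. Qed.

Lemma tlift_linear (V : lmodType k) (F : A -> B -> V) :
  bilin F -> linear (tlift F).
Proof. by move=> bF c t u; rewrite (tliftD bF) (tliftZ bF). Qed.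

Lemma tpure_bilin : bilin tpure.
Proof.
split=> [b|a] c u v; apply: tens_eq => V F bF;
  by rewrite (tliftD bF) (tliftZ bF) !tlift_pure //; case: bF => Fl Fr; rewrite ?Fl ?Fr.
Qed.

HB.instance Definition _ (a : A) :=
  GRing.isLinear.Build k B (tens A B) *:%R (tpure a) (tpure_bilin.2 a).

Lemma tpureM a b a' b' : tpure a b * tpure a' b' = tpure (a * a') (b * b').
Proof.
apply: tens_eq => V F bF.
rewrite (tliftM bF) !tlift_pure //; first exact: bilin_transl.
by apply: bilin_tlift => x y; apply: bilin_mul.
Qed.

Lemma tens_sum t : t = \sum_(p <- repr t) tpure p.1 p.2.
Proof.
apply: tens_eq => V F bF; rewrite {1}/tlift /pair_sum.
elim: (repr t) => [|p s IHs]; first by rewrite !big_nil (tlift0 bF).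
by rewrite !big_cons (tliftD bF) tlift_pure // IHs.
Qed.

Lemma linear_tlift (V : lmodType k) (f : {linear tens A B -> V}) t :
  f t = tlift (fun a b => f (tpure a b)) t.
Proof. by rewrite [in LHS](tens_sum t) linear_sum. Qed.

Lemma tens_linear_ext (V : lmodType k) (f g : {linear tens A B -> V}) :
  (forall a b, f (tpure a b) = g (tpure a b)) -> f =1 g.
Proof. by move=> e t; rewrite !linear_tlift; apply: tlift_ext. Qed.

Definition tleft (a : A) : tens A B := tpure a 1.
Definition tright (b : B) : tens A B := tpure 1 b.

Lemma tleft_linear : linear tleft.
Proof. exact: tpure_bilin.1. Qed.
Lemma tright_linear : linear tright.
Proof. exact: tpure_bilin.2. Qed.
Lemma tleft_monoid : monoid_morphism tleft.
Proof. by split=> // a b; rewrite tpureM mulr1. Qed.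
Lemma tright_monoid : monoid_morphism tright.
Proof. by split=> // a b; rewrite tpureM mulr1. Qed.
HB.instance Definition _ := GRing.isLinear.Build k A (tens A B) *:%R tleft tleft_linear.
HB.instance Definition _ := GRing.isMonoidMorphism.Build A (tens A B) tleft tleft_monoid.
HB.instance Definition _ := GRing.isLinear.Build k B (tens A B) *:%R tright tright_linear.
HB.instance Definition _ := GRing.isMonoidMorphism.Build B (tens A B) tright tright_monoid.

Lemma tpureE a b : tpure a b = tleft a * tright b.
Proof. by rewrite tpureM mulr1 mul1r. Qed.

Section Copair.
Variables (R : comAlgType k) (x : {lrmorphism A -> R}) (y : {lrmorphism B -> R}).

Lemma copair_bilin : bilin (fun a b => x a * y b).
Proof.
by split=> [b|a] c u v; rewrite /= linearP ?mulrDl ?mulrDr -?scalerAl -?scalerAr.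
Qed.

(** On spectra: the point of the product scheme with coordinates [x] and [y]. *)
Definition copair (t : tens A B) : R := tlift (fun a b => x a * y b) t.

Lemma copair_pure a b : copair (tpure a b) = x a * y b.
Proof. exact/tlift_pure/copair_bilin. Qed.

Lemma copair_linear : linear copair.
Proof. exact/tlift_linear/copair_bilin. Qed.

Lemma copair_monoid : monoid_morphism copair.
Proof.
split=> [|t u]; first by rewrite copair_pure !rmorph1 mulr1.
rewrite /copair (tliftM copair_bilin) /tlift /pair_sum mulr_suml.
apply: eq_bigr => p _; rewrite mulr_sumr; apply: eq_bigr => q _.
by rewrite !rmorphM mulrACA.
Qed.
HB.instance Definition _ := GRing.isLinear.Build k (tens A B) R *:%R copair copair_linear.
HB.instance Definition _ := GRing.isMonoidMorphism.Build (tens A B) R copair copair_monoid.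

Lemma copair_left a : copair (tleft a) = x a.
Proof. by rewrite copair_pure rmorph1 mulr1. Qed.
Lemma copair_right b : copair (tright b) = y b.
Proof. by rewrite copair_pure rmorph1 mul1r. Qed.
End Copair.

Lemma tens_hom_ext (R : comAlgType k) (f g : {lrmorphism tens A B -> R}) :
  (forall a, f (tleft a) = g (tleft a)) ->
  (forall b, f (tright b) = g (tright b)) -> f =1 g.
Proof.
move=> fgl fgr; apply: tens_linear_ext => a b.
have hE (h : {lrmorphism tens A B -> R}) :
  h (tpure a b) = h (tleft a) * h (tright b) by rewrite tpureE rmorphM.
by apply: etrans (hE f) _; apply: etrans (esym (hE g)); rewrite fgl fgr.
Qed.

Section Slices.
Variables (lam : {linear A -> k^o}) (mu : {linear B -> k^o}).

Lemma lslice_bilin : bilin (fun (a : A) (b : B) => (lam a : k) *: b).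
Proof.
split=> [b|a] c u v; rewrite linearP //=; first by rewrite scalerDl scalerA.
Qed.
Lemma rslice_bilin : bilin (fun (a : A) (b : B) => (mu b : k) *: a).
Proof.
split=> [b|a] c u v; rewrite linearP //=; first by rewrite scalerDl scalerA.
Qed.

(** The maps lam (x) id and id (x) mu. *)
Definition lslice (t : tens A B) : B := tlift (fun a b => (lam a : k) *: b) t.
Definition rslice (t : tens A B) : A := tlift (fun a b => (mu b : k) *: a) t.

HB.instance Definition _ :=
  GRing.isLinear.Build k (tens A B) B *:%R lslice (tlift_linear lslice_bilin).
HB.instance Definition _ :=
  GRing.isLinear.Build k (tens A B) A *:%R rslice (tlift_linear rslice_bilin).

Lemma lslice_pure a b : lslice (tpure a b) = (lam a : k) *: b.
Proof. exact/tlift_pure/lslice_bilin. Qed.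
Lemma rslice_pure a b : rslice (tpure a b) = (mu b : k) *: a.
Proof. exact/tlift_pure/rslice_bilin. Qed.
End Slices.

Lemma tpure_suml (I : Type) (s : seq I) (a : I -> A) b :
  tpure (\sum_(i <- s) a i) b = \sum_(i <- s) tpure (a i) b.
Proof.
have [lin _] := tpure_bilin.
pose f := HB.pack_for {linear A -> tens A B} (tpure^~ b)
  (GRing.isLinear.Build k A (tens A B) *:%R _ (lin b)).
exact: (linear_sum f).
Qed.
Lemma tpure_sumr (I : Type) (s : seq I) a (b : I -> B) :
  tpure a (\sum_(i <- s) b i) = \sum_(i <- s) tpure a (b i).
Proof. exact: linear_sum. Qed.
Lemma tpureZl c a b : tpure (c *: a) b = c *: tpure a b.
Proof. exact: (GRing.scalable_linear (tpure_bilin.1 b)). Qed.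
Lemma tpureZr c a b : tpure a (c *: b) = c *: tpure a b.
Proof. exact: (GRing.scalable_linear (tpure_bilin.2 a)). Qed.
End TensorMaps.

#[global] Opaque tlift lslice rslice copair.

Arguments tleft {k A B}.
Arguments tright {k A B}.

Section TensorSlices.
Variables (k : fieldType) (A B : comAlgType k).

(** In a dual basis for the left components of [t], the coefficient of [e i] is
    the slice of [t] by the [i]-th form. *)
Lemma lslice_expand_seq (W : A -> Prop) (s : seq (A * B)) :
  subspace W -> (forall p, p \in s -> W p.1) ->
  exists (n : nat) (lam : nat -> {linear A -> k^o}) (e : nat -> A),
    (forall i, W (e i)) /\
    let t := \sum_(p <- s) tpure p.1 p.2 in
    t = \sum_(i < n) tpure (e i) (lslice (lam i) t).
Proof.
move=> subW sW.
have [|n [lam [e [lamE We]]]] := @dual_basis _ _ W [seq p.1 | p <- s] subW.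
  by move=> a /mapP[p ps ->]; apply: sW.
exists n, lam, e; split=> //=.
have tE i : tpure (e i) (lslice (lam i) (\sum_(p <- s) tpure p.1 p.2)) =
    \sum_(p <- s) tpure ((lam i p.1 : k) *: e i) p.2.
  rewrite (linear_sum (lslice (lam i))) tpure_sumr; apply: eq_bigr => p _ /=.
  by rewrite lslice_pure tpureZr -tpureZl.
under [RHS]eq_bigr => i _ do rewrite tE.
rewrite exchange_big /=; apply: eq_big_seq => p ps.
by rewrite -tpure_suml -lamE // map_f.
Qed.

Definition tswap : tens A B -> tens B A := copair tright tleft.

Lemma tswap_pure a b : tswap (tpure a b) = tpure b a.
Proof. by rewrite /tswap copair_pure mulrC -tpureE. Qed.

HB.instance Definition _ := GRing.LRMorphism.on tswap.
End TensorSlices.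

Section TensorRange.
Variables (k : fieldType) (A B : comAlgType k).

Lemma tswapK : cancel (@tswap k A B) (@tswap k B A).
Proof.
apply: (@tens_linear_ext _ _ _ _ (@tswap k B A \o @tswap k A B) idfun) => a b.
by rewrite /= !tswap_pure.
Qed.

Lemma lslice_swap (lam : {linear B -> k^o}) (t : tens A B) :
  lslice lam (tswap t) = rslice lam t.
Proof.
apply: (@tens_linear_ext _ _ _ _ (lslice lam \o @tswap k A B) (rslice lam)).
by move=> a b; rewrite /= tswap_pure lslice_pure rslice_pure.
Qed.

Lemma rslice_swap (lam : {linear A -> k^o}) (t : tens A B) :
  rslice lam (tswap t) = lslice lam t.
Proof.
apply: (@tens_linear_ext _ _ _ _ (rslice lam \o @tswap k A B) (lslice lam)).
by move=> a b; rewrite /= tswap_pure lslice_pure rslice_pure.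
Qed.

Lemma lslice_expand (t : tens A B) :
  exists (n : nat) (lam : nat -> {linear A -> k^o}) (e : nat -> A),
    t = \sum_(i < n) tpure (e i) (lslice (lam i) t).
Proof.
have [//|//|n [lam [e [_ tE]]]] := @lslice_expand_seq k A B (fun=> True) (repr t).
rewrite -tens_sum /= in tE.
by exists n, lam, e.
Qed.

Lemma rslice_expand (t : tens A B) :
  exists (n : nat) (mu : nat -> {linear B -> k^o}) (e : nat -> B),
    t = \sum_(i < n) tpure (rslice (mu i) t) (e i).
Proof.
have [//|//|n [mu [e [_ tE]]]] := @lslice_expand_seq k B A (fun=> True) (repr (tswap t)).
rewrite -tens_sum /= in tE.
exists n, mu, e; rewrite -[LHS]tswapK {1}tE linear_sum; apply: eq_bigr => i _ /=.
by rewrite tswap_pure lslice_swap.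
Qed.

Lemma lslice_inj (t u : tens A B) :
  (forall lam, lslice lam t = lslice lam u) -> t = u.
Proof.
move=> e; apply/eqP; rewrite -subr_eq0; apply/eqP.
have [n [lam [f ->]]] := lslice_expand (t - u).
apply: big1 => i _; rewrite linearB /= e subrr.
by rewrite -(scale0r 0) tpureZr scale0r.
Qed.

Lemma rslice_inj (t u : tens A B) :
  (forall mu, rslice mu t = rslice mu u) -> t = u.
Proof.
move=> e; have [n [mu [f tE]]] := rslice_expand (t - u).
apply/eqP; rewrite -subr_eq0 tE; apply/eqP; apply: big1 => i _.
by rewrite linearB /= e subrr -(scale0r 0) tpureZl scale0r.
Qed.

(** This is the subspace P (x) Q, by [in_tens_expand]: over a field it is
    detected by slices. *)
Definition in_tens (P : A -> Prop) (Q : B -> Prop) (t : tens A B) : Prop :=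
  (forall mu, P (rslice mu t)) /\ (forall lam, Q (lslice lam t)).

(** An expansion along the right factor has slices, hence elements of [P], as
    left components.  Expanding these in a dual basis chosen inside [P] makes
    the right components slices too, hence elements of [Q]. *)
Lemma in_tens_expand P Q t : subspace P -> in_tens P Q t ->
  exists (n : nat) (a : nat -> A) (b : nat -> B),
    [/\ forall i, P (a i), forall i, Q (b i) &
        t = \sum_(i < n) tpure (a i) (b i)].
Proof.
move=> subP [tP tQ].
have [m [mu [f tE]]] := rslice_expand t.
pose s := [seq (rslice (mu i) t, f i) | i <- index_iota 0 m].
have tEs : t = \sum_(p <- s) tpure p.1 p.2 by rewrite big_map big_mkord.
have [p|n [lam [e [We {}tE]]]] := @lslice_expand_seq k A B P s subP.
  by move=> /mapP[i _ ->] /=; apply: tP.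
rewrite -tEs /= in tE.
by exists n, e, (fun i => lslice (lam i) t).
Qed.

Lemma in_tens_pure P Q a b : subspace P -> subspace Q -> P a -> Q b ->
  in_tens P Q (tpure a b).
Proof.
move=> [P0 PD] [Q0 QD] Pa Qb; split=> [mu|lam].
  by rewrite rslice_pure -[_ *: _]addr0; apply: PD.
by rewrite lslice_pure -[_ *: _]addr0; apply: QD.
Qed.

Lemma in_tens_subspace P Q : subspace P -> subspace Q -> subspace (in_tens P Q).
Proof.
move=> [P0 PD] [Q0 QD]; split.
  by split=> ?; rewrite linear0.
move=> c t u [tP tQ] [uP uQ].
split=> [mu|lam]; rewrite linearP /=.
  by apply: PD; [apply: tP|apply: uP].
by apply: QD; [apply: tQ|apply: uQ].
Qed.
End TensorRange.

(** * Functoriality and associativity of tensor products *)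

Section HomComp.
Variables (k : fieldType).

Definition hcomp (A B C : comAlgType k) (f : {lrmorphism B -> C})
  (g : {lrmorphism A -> B}) : {lrmorphism A -> C} := f \o g.

Lemma hcompE (A B C : comAlgType k) (f : {lrmorphism B -> C})
  (g : {lrmorphism A -> B}) a : hcomp f g a = f (g a).
Proof. by []. Qed.
End HomComp.

Notation "f \oR g" := (hcomp f g) (at level 50, left associativity).

Lemma hcompA (k : fieldType) (A B C D : comAlgType k) (f : {lrmorphism C -> D})
  (g : {lrmorphism B -> C}) (h : {lrmorphism A -> B}) :
  f \oR (g \oR h) = f \oR g \oR h.
Proof. exact: lrmorphism_ext. Qed.

Section Factor.
Variables (k : fieldType) (A B C : comAlgType k).

(** Morphisms to a tensor product of subalgebras arise this way, from morphisms
    to the tensor product of the ambient algebras. *)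
Lemma factor_hom (f : {lrmorphism A -> C}) (j : {lrmorphism B -> C}) :
  injective j -> (forall a, exists b, j b = f a) ->
  exists g : {lrmorphism A -> B}, forall a, j (g a) = f a.
Proof.
move=> jI /choice[g gE].
have glin : linear g.
  by move=> c u v; apply: jI; rewrite gE !linearP /= !gE.
have gmon : monoid_morphism g.
  by split=> [|u v]; apply: jI; rewrite gE ?rmorph1 // !rmorphM /= !gE.
by exists (HB.pack_for {lrmorphism A -> B} g
  (GRing.isLinear.Build k A B *:%R g glin)
  (GRing.isMonoidMorphism.Build A B g gmon)).
Qed.
End Factor.

Section TensorMap.
Variables (k : fieldType) (A B A' B' : comAlgType k).
Variables (f : {lrmorphism A' -> A}) (g : {lrmorphism B' -> B}).

Definition tmap : tens A' B' -> tens A B := copair (tleft \oR f) (tright \oR g).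
HB.instance Definition _ := GRing.LRMorphism.on tmap.

Lemma tmap_pure a b : tmap (tpure a b) = tpure (f a) (g b).
Proof. by rewrite /tmap copair_pure tpureE. Qed.

Lemma tmap_left a : tmap (tleft a) = tleft (f a).
Proof. by rewrite /tmap copair_left. Qed.
Lemma tmap_right b : tmap (tright b) = tright (g b).
Proof. by rewrite /tmap copair_right. Qed.

Lemma lslice_tmap (lam : {linear A -> k^o}) t :
  lslice lam (tmap t) = g (lslice (lam \o f) t).
Proof.
apply: (@tens_linear_ext _ _ _ _ (lslice lam \o tmap) (g \o lslice (lam \o f))).
by move=> a b; rewrite /= tmap_pure !lslice_pure linearZ.
Qed.

Lemma rslice_tmap (mu : {linear B -> k^o}) t :
  rslice mu (tmap t) = f (rslice (mu \o g) t).
Proof.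
apply: (@tens_linear_ext _ _ _ _ (rslice mu \o tmap) (f \o rslice (mu \o g))).
by move=> a b; rewrite /= tmap_pure !rslice_pure linearZ.
Qed.
End TensorMap.

(** Slices commute with f (x) g, so injectivity can be tested on slices, one
    factor at a time. *)
Lemma tmap_inj (k : fieldType) (A B A' B' : comAlgType k)
    (f : {lrmorphism A' -> A}) (g : {lrmorphism B' -> B}) :
  injective f -> injective g -> injective (tmap f g).
Proof.
move=> fI gI t u e; apply: rslice_inj => mu; apply: fI.
rewrite -!(rslice_tmap f idfun); congr (rslice _ _).
apply: lslice_inj => lam; apply: gI.
by rewrite !lslice_tmap /= -!lslice_tmap e.
Qed.

Lemma tens_linear_ext3 (k : fieldType) (A B C : comAlgType k) (V : lmodType k)
    (f g : {linear tens A (tens B C) -> V}) :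
  (forall a b c, f (tpure a (tpure b c)) = g (tpure a (tpure b c))) -> f =1 g.
Proof.
move=> e; apply: tens_linear_ext => a t.
by apply: (tens_linear_ext (f := f \o tpure a) (g := g \o tpure a)) => b c /=; apply: e.
Qed.

Section Associativity.
Variables (k : fieldType) (A B C : comAlgType k).

Definition assoc : tens A (tens B C) -> tens (tens A B) C :=
  copair (tleft \oR tleft) (copair (tleft \oR tright) tright).
HB.instance Definition _ := GRing.LRMorphism.on assoc.

Lemma assoc_pure a b c : assoc (tpure a (tpure b c)) = tpure (tpure a b) c.
Proof.
by rewrite /assoc copair_pure /= copair_pure /= mulrA -rmorphM -!tpureE.
Qed.

(** This and the next two lemmas are the three ways to slice a triple tensor by
    two forms.  They turn coassociativity into identities between slices. *)
Lemma lslice_rslice_assoc (lam : {linear A -> k^o}) (mu : {linear C -> k^o}) t :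
  lslice lam (rslice mu (assoc t)) = rslice mu (lslice lam t).
Proof.
apply: (tens_linear_ext3 (f := lslice lam \o rslice mu \o assoc)
  (g := rslice mu \o lslice lam)) => a b c /=.
rewrite assoc_pure rslice_pure lslice_pure !linearZ /=.
by rewrite lslice_pure rslice_pure !scalerA; congr (_ *: _); apply: mulrC.
Qed.

Lemma lslice_assoc (lam : {linear A -> k^o}) (nu : {linear B -> k^o}) t :
  lslice (nu \o lslice lam) (assoc t) = lslice nu (lslice lam t).
Proof.
apply: (tens_linear_ext3 (f := lslice (nu \o lslice lam) \o assoc)
  (g := lslice nu \o lslice lam)) => a b c /=.
rewrite assoc_pure !lslice_pure /= lslice_pure !linearZ /=.
by rewrite lslice_pure !scalerA.
Qed.

Lemma rslice_rslice_assoc (nu : {linear B -> k^o}) (mu : {linear C -> k^o}) t :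
  rslice nu (rslice mu (assoc t)) = rslice (mu \o lslice nu) t.
Proof.
apply: (tens_linear_ext3 (f := rslice nu \o rslice mu \o assoc)
  (g := rslice (mu \o lslice nu))) => a b c /=.
rewrite assoc_pure !rslice_pure /= lslice_pure !linearZ /=.
by rewrite rslice_pure !scalerA; congr (_ *: _); apply: mulrC.
Qed.
End Associativity.

(** * Subalgebras *)

Record subalg (k : fieldType) (A : comAlgType k) := Subalg {
  sap :> A -> Prop;
  sa_subspace : subspace sap;
  sa1 : sap 1;
  saM : forall a b, sap a -> sap b -> sap (a * b)
}.

Section SubalgType.
Variables (k : fieldType) (A : comAlgType k) (S : subalg A).

Definition subalg_pred : A -> bool := fun a => `[< S a >].

Lemma subalg_predP : GRing.subsemialg_closed subalg_pred.
Proof.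
have [S0 SD] := sa_subspace S.
apply: GRing.subalg_closed_semi; split; first by apply/asboolP; apply: sa1.
  by move=> c u v /asboolP Su /asboolP Sv; apply/asboolP; apply: SD.
by move=> u v /asboolP Su /asboolP Sv; apply/asboolP; apply: saM.
Qed.
HB.instance Definition _ := GRing.isSubalgClosed.Build k A subalg_pred subalg_predP.

Inductive subalg_of := SubalgOf a & subalg_pred a.
Definition subalg_val u := let: SubalgOf a _ := u in a.
HB.instance Definition _ := [isSub for subalg_val].
HB.instance Definition _ := [Choice of subalg_of by <:].
HB.instance Definition _ := [SubChoice_isSubComNzRing of subalg_of by <:].
HB.instance Definition _ := [SubZmodule_isSubLmodule of subalg_of by <:].
HB.instance Definition _ := [SubNzRing_SubLmodule_isSubLalgebra of subalg_of by <:].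
HB.instance Definition _ := [SubLalgebra_isSubAlgebra of subalg_of by <:].

Lemma subalg_val_linear : linear subalg_val.
Proof. by []. Qed.
Lemma subalg_val_monoid : monoid_morphism subalg_val.
Proof. by []. Qed.
Definition sincl : {lrmorphism subalg_of -> A} :=
  HB.pack_for {lrmorphism subalg_of -> A} subalg_val
  (GRing.isLinear.Build k subalg_of A *:%R subalg_val subalg_val_linear)
  (GRing.isMonoidMorphism.Build subalg_of A subalg_val subalg_val_monoid).

Lemma sincl_inj : injective sincl.
Proof. exact: val_inj. Qed.

Lemma sinclP u : S (sincl u).
Proof. by case: u => a Sa; apply/asboolP. Qed.

Lemma sincl_onto a : S a -> exists u, sincl u = a.
Proof. by move=> /asboolP Sa; exists (SubalgOf Sa). Qed.

Lemma corestrict (B : comAlgType k) (f : {lrmorphism B -> A}) :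
  (forall b, S (f b)) ->
  exists g : {lrmorphism B -> subalg_of}, forall b, sincl (g b) = f b.
Proof.
by move=> Sf; apply: factor_hom sincl_inj _ => b; apply: sincl_onto.
Qed.
End SubalgType.

Arguments sincl {k A S}.
#[global] Opaque sincl.

Lemma subalgZ (k : fieldType) (A : comAlgType k) (S : subalg A) (c : k) (a : A) :
  S a -> S (c *: a).
Proof.
have [S0 SD] := sa_subspace S.
by move=> Sa; rewrite -[_ *: _]addr0; apply: SD.
Qed.

Section TensorSubalg.
Variables (k : fieldType) (A B : comAlgType k) (S : subalg A) (T : subalg B).

Lemma tens_subalg1 : in_tens S T (1 : tens A B).
Proof. by apply: in_tens_pure; try exact: sa_subspace; apply: sa1. Qed.

Lemma tens_subalgM t u : in_tens S T t -> in_tens S T u -> in_tens S T (t * u).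
Proof.
have subST := in_tens_subspace (sa_subspace S) (sa_subspace T).
move=> /(in_tens_expand (sa_subspace S))[n [a [b [Sa Tb ->]]]].
move=> /(in_tens_expand (sa_subspace S))[m [a' [b' [Sa' Tb' ->]]]].
rewrite mulr_suml; under eq_bigr => i _ do rewrite -[_ * _]scale1r.
apply: (@subspace_sum _ _ (in_tens S T) 'I_n _ (fun=> 1)) => // i.
rewrite mulr_sumr; under eq_bigr => j _ do rewrite -[_ * _]scale1r.
apply: (@subspace_sum _ _ (in_tens S T) 'I_m _ (fun=> 1)) => // j.
by rewrite tpureM; apply: in_tens_pure; try exact: sa_subspace; apply: saM.
Qed.

Definition tens_subalg : subalg (tens A B) :=
  Subalg (in_tens_subspace (sa_subspace S) (sa_subspace T))
    tens_subalg1 tens_subalgM.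

(** Tensors recognized by their slices come from the tensor product of the
    subalgebras. *)
Lemma tens_subalg_onto t : tens_subalg t ->
  exists u : tens (subalg_of S) (subalg_of T), tmap sincl sincl u = t.
Proof.
move=> /(in_tens_expand (sa_subspace S))[n [a [b [Sa Tb ->]]]].
have /choice[a' aE] i := sincl_onto (Sa i).
have /choice[b' bE] i := sincl_onto (Tb i).
exists (\sum_(i < n) tpure (a' i) (b' i)).
by rewrite linear_sum; apply: eq_bigr => i _ /=; rewrite tmap_pure aE bE.
Qed.

Lemma tmap_sincl_inj :
  injective (tmap (@sincl k A S) (@sincl k B T)).
Proof. by apply: tmap_inj; apply: sincl_inj. Qed.

Lemma tens_corestrict (C : comAlgType k) (f : {lrmorphism C -> tens A B}) :
  (forall c, tens_subalg (f c)) ->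
  exists g : {lrmorphism C -> tens (subalg_of S) (subalg_of T)},
    forall c, tmap sincl sincl (g c) = f c.
Proof.
move=> Sf; apply: (@factor_hom _ _ _ _ f (tmap sincl sincl)) tmap_sincl_inj _.
by move=> c; apply: tens_subalg_onto.
Qed.
End TensorSubalg.

Definition preim_subalg (k : fieldType) (A B : comAlgType k)
  (f : {lrmorphism A -> B}) (S : subalg B) : subalg A.
Proof.
apply: (@Subalg _ _ (fun a => S (f a))).
- have [S0 SD] := sa_subspace S; split=> [|c u v]; first by rewrite linear0.
  by rewrite linearP; apply: SD.
- by rewrite rmorph1; apply: sa1.
- by move=> a b; rewrite rmorphM; apply: saM.
Defined.

(** * The Hopf algebra of an affine group and its coactions *)

Section ScalarHom.
Variables (k : fieldType) (R : comAlgType k).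

Definition scalar_hom (c : k^o) : R := (c : k) *: 1.

Lemma scalar_hom_linear : linear scalar_hom.
Proof. by move=> c u v; rewrite /scalar_hom scalerDl scalerA. Qed.
Lemma scalar_hom_monoid : monoid_morphism scalar_hom.
Proof.
split=> [|u v]; first by rewrite /scalar_hom scale1r.
by rewrite /scalar_hom -scalerAl mul1r scalerA.
Qed.
HB.instance Definition _ := GRing.isLinear.Build k k^o R *:%R scalar_hom scalar_hom_linear.
HB.instance Definition _ := GRing.isMonoidMorphism.Build k^o R scalar_hom scalar_hom_monoid.
End ScalarHom.

Section GroupPoints.
Variables (k : fieldType) (G : affGroup k).
Notation H := (gring G).

Section Fixed.
Variable R : comAlgType k.
Implicit Types x y z : Spec H R.

Lemma gmulI x y z : gmul x y = gmul x z -> y = z.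
Proof.
by move=> e; rewrite -[y]gmul1g -[z]gmul1g -(gmulVg x) -!gmulA e.
Qed.

Lemma gmulg1 x : gmul x (gone G R) = x.
Proof. by apply: (@gmulI (ginv x)); rewrite gmulA gmulVg gmul1g. Qed.

Lemma gmulgV x : gmul x (ginv x) = gone G R.
Proof. by apply: (@gmulI (ginv x)); rewrite gmulA gmulVg gmul1g gmulg1. Qed.

Lemma ginv_unique x y : gmul x y = gone G R -> y = ginv x.
Proof. by move=> e; apply: (@gmulI x); rewrite e gmulgV. Qed.

Lemma ginvK x : ginv (ginv x) = x.
Proof. by apply/esym/ginv_unique; rewrite gmulVg. Qed.

Lemma ginvM x y : ginv (gmul x y) = gmul (ginv y) (ginv x).
Proof.
apply/esym/ginv_unique.
by rewrite -gmulA [gmul y _]gmulA gmulgV gmul1g gmulgV.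
Qed.
End Fixed.

Lemma gmul_spec_nat (R S : comAlgType k) (f : {lrmorphism R -> S})
  (x y : Spec H R) :
  spec_map f (gmul x y) = gmul (spec_map f x) (spec_map f y).
Proof. exact: gmul_nat. Qed.

(** The image of the unit is idempotent, and an idempotent of a group is its
    unit. *)
Lemma gone_nat (R S : comAlgType k) (f : {lrmorphism R -> S}) :
  spec_map f (gone G R) = gone G S.
Proof.
apply: (@gmulI _ (spec_map f (gone G R))).
by rewrite -gmul_spec_nat gmul1g gmulg1.
Qed.

Lemma ginv_nat (R S : comAlgType k) (f : {lrmorphism R -> S}) (x : Spec H R) :
  spec_map f (ginv x) = ginv (spec_map f x).
Proof. by apply: ginv_unique; rewrite -gmul_spec_nat gmulgV gone_nat. Qed.

(** By the Yoneda lemma, multiplication is determined by the product of the two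
    universal points over H (x) H. *)
Definition comul : {lrmorphism H -> tens H H} :=
  gmul (tleft : {lrmorphism H -> tens H H}) (tright : {lrmorphism H -> tens H H}).

Definition antipode : {lrmorphism H -> H} := ginv (idfun : {lrmorphism H -> H}).

Definition counit : {lrmorphism H -> k^o} := gone G k^o.

Lemma gmulE (R : comAlgType k) (x y : {lrmorphism H -> R}) h :
  (gmul x y : {lrmorphism H -> R}) h = copair x y (comul h).
Proof.
have := gmul_spec_nat (copair x y) (tleft : {lrmorphism H -> tens H H})
  (tright : {lrmorphism H -> tens H H}).
have -> : spec_map (copair x y) (tleft : {lrmorphism H -> tens H H}) = x.
  by apply: lrmorphism_ext => a; apply: copair_left.
have -> : spec_map (copair x y) (tright : {lrmorphism H -> tens H H}) = y.
  by apply: lrmorphism_ext => a; apply: copair_right.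
by move=> <-.
Qed.

Lemma ginvE (R : comAlgType k) (x : {lrmorphism H -> R}) h :
  (ginv x : {lrmorphism H -> R}) h = x (antipode h).
Proof.
have := ginv_nat x (idfun : {lrmorphism H -> H}).
have -> : spec_map x (idfun : {lrmorphism H -> H}) = x by apply: lrmorphism_ext.
by move=> <-.
Qed.

Lemma goneE (R : comAlgType k) h :
  (gone G R : {lrmorphism H -> R}) h = (counit h : k) *: 1.
Proof. by rewrite -(gone_nat (scalar_hom R : {lrmorphism k^o -> R})). Qed.

(** The right regular action, through which the identities for coactions apply
    to the comultiplication. *)
Definition gmul_action : action G (Spec H) :=
  @Action k G (Spec H) (fun R x g => gmul x g) (fun R x => gmulg1 x)
    (fun R x g h => gmulA x g h) (fun R S f x g => gmul_nat f x g).
End GroupPoints.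

Section Coaction.
Variables (k : fieldType) (G : affGroup k) (A : comAlgType k).
Variable a : action G (Spec A).
Notation H := (gring G).

Definition act_on (R : comAlgType k) (x : {lrmorphism A -> R})
  (g : {lrmorphism H -> R}) : {lrmorphism A -> R} := act a x g.

Definition coact : {lrmorphism A -> tens A H} := act_on tleft tright.

Lemma act_onM (R : comAlgType k) (x : {lrmorphism A -> R})
    (g h : {lrmorphism H -> R}) :
  act_on x (gmul g h) = act_on (act_on x g) h.
Proof. exact: (actM a x g h). Qed.

Lemma act_on1 (R : comAlgType k) (x : {lrmorphism A -> R}) :
  act_on x (gone G R) = x.
Proof. exact: (act1 a x). Qed.

Lemma act_onE (R : comAlgType k) (x : {lrmorphism A -> R})
    (g : {lrmorphism H -> R}) u : act_on x g u = copair x g (coact u).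
Proof.
have : spec_map (copair x g) (coact : Spec A (tens A H)) =
       act_on (spec_map (copair x g) (tleft : {lrmorphism A -> tens A H}))
              (spec_map (copair x g) (tright : {lrmorphism H -> tens A H})).
  exact: (act_nat a (copair x g)).
have -> : spec_map (copair x g) (tleft : {lrmorphism A -> tens A H}) = x.
  by apply: lrmorphism_ext => b; apply: copair_left.
have -> : spec_map (copair x g) (tright : {lrmorphism H -> tens A H}) = g.
  by apply: lrmorphism_ext => b; apply: copair_right.
by move=> <-.
Qed.

(** This is x.(gh) = (x.g).h at the universal triple, over (A (x) H) (x) H. *)
Lemma coact_coassoc u :
  tmap coact idfun (coact u) = assoc (tmap idfun (comul G) (coact u)).
Proof.
pose x : {lrmorphism A -> tens (tens A H) H} := tleft \oR tleft.
pose g : {lrmorphism H -> tens (tens A H) H} := tleft \oR tright.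
pose h : {lrmorphism H -> tens (tens A H) H} := tright.
have xgE b : act_on x g b = tleft (coact b).
  rewrite act_onE.
  apply: (tens_hom_ext (f := copair x g) (g := tleft)) => c.
    by rewrite /= copair_left.
  by rewrite /= copair_right.
have lE t : tmap coact idfun t = copair (act_on x g) h t.
  apply: (tens_hom_ext (f := tmap coact idfun) (g := copair (act_on x g) h)) => b.
    by rewrite /= /tmap !copair_left xgE.
  by rewrite /= /tmap !copair_right.
have ghE t : assoc (tmap idfun (comul G) t) = copair x (gmul g h) t.
  apply: (tens_hom_ext (f := @assoc k A H H \o tmap idfun (comul G))
    (g := copair x (gmul g h))) => b.
    by rewrite /= /tmap !copair_left /= /assoc copair_left.
  rewrite /= copair_right gmulE /= /tmap copair_right /= /assoc copair_right.
  by [].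
rewrite lE ghE -!act_onE.
by rewrite act_onM.
Qed.
End Coaction.

#[global] Opaque act_on coact.

Section CoactionSlices.
Variables (k : fieldType) (G : affGroup k) (A : comAlgType k).
Variable a : action G (Spec A).
Notation H := (gring G).
Notation rho := (coact a).
Notation Delta := (comul G).

Lemma lslice_rslice_coact (lam : {linear A -> k^o}) (mu : {linear H -> k^o}) u :
  lslice lam (rho (rslice mu (rho u))) = rslice mu (Delta (lslice lam (rho u))).
Proof.
rewrite -(rslice_tmap rho idfun) coact_coassoc lslice_rslice_assoc.
by rewrite (lslice_tmap idfun Delta).
Qed.

Lemma lslice_lslice_coact (lam : {linear A -> k^o}) (nu : {linear H -> k^o}) u :
  lslice nu (Delta (lslice lam (rho u))) =
  lslice (nu \o lslice lam \o rho) (rho u).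
Proof.
rewrite -(lslice_tmap idfun Delta) /= -lslice_assoc -coact_coassoc.
by rewrite (lslice_tmap rho idfun).
Qed.

Lemma rslice_rslice_coact (mu nu : {linear H -> k^o}) u :
  rslice nu (rho (rslice mu (rho u))) =
  rslice (mu \o lslice nu \o Delta) (rho u).
Proof.
rewrite -(rslice_tmap rho idfun) coact_coassoc rslice_rslice_assoc.
by rewrite (rslice_tmap idfun Delta).
Qed.
End CoactionSlices.

Section HopfIdentities.
Variables (k : fieldType) (G : affGroup k).
Notation H := (gring G).
Notation Delta := (comul G).
Notation S := (antipode G).

Lemma lslice_counit h : lslice (counit G) (Delta h) = h.
Proof.
have e : gmul (gone G H) (idfun : {lrmorphism H -> H}) = idfun by apply: gmul1g.
transitivity ((gmul (gone G H) (idfun : {lrmorphism H -> H}) : {lrmorphism H -> H}) h);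
  last by rewrite e.
rewrite gmulE.
apply: (tens_linear_ext (f := lslice (counit G)) (g := copair _ _)) => x y /=.
by rewrite lslice_pure copair_pure goneE -scalerAl mul1r.
Qed.

Lemma rslice_counit h : rslice (counit G) (Delta h) = h.
Proof.
have e : gmul (idfun : {lrmorphism H -> H}) (gone G H) = idfun by apply: gmulg1.
transitivity ((gmul (idfun : {lrmorphism H -> H}) (gone G H) : {lrmorphism H -> H}) h);
  last by rewrite e.
rewrite gmulE.
apply: (tens_linear_ext (f := rslice (counit G)) (g := copair _ _)) => x y /=.
by rewrite rslice_pure copair_pure goneE -scalerAr mulr1.
Qed.

Lemma antipodeK h : S (S h) = h.
Proof.
by rewrite -ginvE /antipode (ginvK (idfun : {lrmorphism H -> H})).
Qed.

(** This is (gh)^-1 = h^-1 g^-1 at the universal pair. *)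
Lemma comul_antipode h : Delta (S h) = tswap (tmap S S (Delta h)).
Proof.
pose l : {lrmorphism H -> tens H H} := tleft.
pose r : {lrmorphism H -> tens H H} := tright.
have e : ginv (gmul l r) = gmul (ginv r) (ginv l) by apply: ginvM.
rewrite -ginvE /comul e gmulE.
apply: (tens_hom_ext (f := copair (ginv r) (ginv l)) (g := @tswap _ H H \o tmap S S)) => x /=.
  by rewrite copair_left ginvE /tmap copair_left /= /tswap copair_left.
by rewrite copair_right ginvE /tmap copair_right /= /tswap copair_right.
Qed.

Lemma lslice_comul_antipode (lam : {linear H -> k^o}) h :
  lslice lam (Delta (S h)) = S (rslice (lam \o S) (Delta h)).
Proof. by rewrite comul_antipode lslice_swap rslice_tmap. Qed.

Lemma rslice_comul_antipode (lam : {linear H -> k^o}) h :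
  rslice lam (Delta (S h)) = S (lslice (lam \o S) (Delta h)).
Proof. by rewrite comul_antipode rslice_swap lslice_tmap. Qed.
End HopfIdentities.

(** * Finitely generated Hopf subalgebras *)

Section Generation.
Variables (k : fieldType).

Definition vspan (V : lmodType k) (s : seq V) (v : V) : Prop :=
  forall W : V -> Prop, subspace W -> (forall x, x \in s -> W x) -> W v.

Lemma vspan_subspace (V : lmodType k) (s : seq V) : subspace (vspan s).
Proof.
split=> [W [W0 _] //|c u v su sv W subW sW].
by have [_ WD] := subW; apply: WD; [apply: su|apply: sv].
Qed.

Lemma vspan_mem (V : lmodType k) (s : seq V) v : v \in s -> vspan s v.
Proof. by move=> sv W _; apply. Qed.

Definition generated (A : comAlgType k) (s : seq A) : subalg A.
Proof.
apply: (@Subalg _ _ (fun a => forall T : subalg A, (forall x, x \in s -> T x) -> T a)).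
- split=> [T _|c u v su sv T sT]; first exact: (sa_subspace T).1.
  by apply: (sa_subspace T).2; [apply: su|apply: sv].
- by move=> T _; apply: sa1.
- by move=> a b sa sb T sT; apply: saM; [apply: sa|apply: sb].
Defined.

Lemma generated_mem (A : comAlgType k) (s : seq A) a : a \in s -> generated s a.
Proof. by move=> sa T; apply. Qed.

Lemma generated_min (A : comAlgType k) (s : seq A) (T : subalg A) a :
  (forall x, x \in s -> T x) -> generated s a -> T a.
Proof. by move=> sT; apply. Qed.

Lemma vspan_generated (A : comAlgType k) (s : seq A) (T : subalg A) a :
  (forall x, x \in s -> T x) -> vspan s a -> T a.
Proof. by move=> sT; apply=> //; apply: sa_subspace. Qed.
End Generation.

Section HopfSubalgebras.
Variables (k : fieldType) (G : affGroup k).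
Notation H := (gring G).
Notation Delta := (comul G).
Notation S := (antipode G).

Definition is_hopf (P : subalg H) : Prop :=
  (forall h, P h -> in_tens P P (Delta h)) /\ (forall h, P h -> P (S h)).

(** A matrix coefficient of [h]: the image of [h] under the iterated
    comultiplication H -> H (x) H (x) H followed by lam (x) id (x) mu. *)
Definition coeff (lam mu : {linear H -> k^o}) (h : H) : H :=
  lslice lam (Delta (rslice mu (Delta h))).

Lemma lslice_rslice_comul (lam mu : {linear H -> k^o}) h :
  lslice lam (Delta (rslice mu (Delta h))) =
  rslice mu (Delta (lslice lam (Delta h))).
Proof. exact: (lslice_rslice_coact (gmul_action G)). Qed.

(** Slicing a matrix coefficient only changes its two forms.  This is why the
    coefficients of [h] span a subcoalgebra. *)
Lemma lslice_coeff (nu lam mu : {linear H -> k^o}) h :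
  lslice nu (Delta (coeff lam mu h)) = coeff (nu \o lslice lam \o Delta) mu h.
Proof. exact: (lslice_lslice_coact (gmul_action G)). Qed.

Lemma rslice_coeff (nu lam mu : {linear H -> k^o}) h :
  rslice nu (Delta (coeff lam mu h)) = coeff lam (mu \o lslice nu \o Delta) h.
Proof.
rewrite /coeff -lslice_rslice_comul; congr (lslice _ (Delta _)).
exact: (rslice_rslice_coact (gmul_action G)).
Qed.

Lemma coeff_counit h : coeff (counit G) (counit G) h = h.
Proof. by rewrite /coeff rslice_counit lslice_counit. Qed.

(** The forms that matter are those of an expansion of Delta h, and then of
    expansions of Delta at the finitely many right slices so obtained. *)
Lemma coeff_finite h : exists s : seq H,
  (forall lam mu, vspan s (coeff lam mu h)) /\
  (forall y, y \in s -> exists lam mu, y = coeff lam mu h).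
Proof.
have [n [mu [f fE]]] := rslice_expand (Delta h).
have /choice[m] l := lslice_expand (Delta (rslice (mu l) (Delta h))).
move=> /choice[lam] /choice[e] eE.
exists [seq coeff (lam l j) (mu l) h | l <- index_iota 0 n, j <- index_iota 0 (m l)].
split=> [la nu|y /allpairsPdep[l [j [_ _ ->]]]]; last by exists (lam l j), (mu l).
set s := [seq _ | l <- _, j <- _].
have sub := vspan_subspace s.
have -> : coeff la nu h = \sum_(l < n) (nu (f l) : k) *:
    \sum_(j < m l) (la (e l j) : k) *: coeff (lam l j) (mu l) h.
  rewrite {1}/coeff {1}fE; rewrite (linear_sum (rslice nu)).
  rewrite (linear_sum Delta) (linear_sum (lslice la)); apply: eq_bigr => l _ /=.
  rewrite rslice_pure !linearZ /= {1}eE (linear_sum (lslice la)); congr (_ *: _).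
  by apply: eq_bigr => j _ /=; rewrite lslice_pure.
apply: (subspace_sum (W := vspan s)) => // l.
apply: (subspace_sum (W := vspan s)) => // j.
suff : coeff (lam l j) (mu l) h \in s by apply: vspan_mem.
apply/allpairsPdep; exists (l : nat), (j : nat).
by rewrite !mem_index_iota /=.
Qed.

(** The matrix coefficients of the elements of [s] span a finite-dimensional
    subcoalgebra, which contains [s] by the counit axioms.  As the antipode
    reverses the comultiplication and is an involution, the algebra generated
    by this subcoalgebra and by its image under the antipode is a Hopf
    subalgebra. *)
Lemma fg_hopf_subalgebra (s : seq H) : exists t : seq H,
  is_hopf (generated t) /\ forall h, h \in s -> generated t h.
Proof.
have /choice[Y YP] := coeff_finite.
pose y := flatten [seq Y h | h <- s].
pose t := y ++ map S y; exists t.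
have yt v : v \in y -> generated t v.
  by move=> vy; apply: generated_mem; rewrite mem_cat vy.
have St v : v \in y -> generated t (S v).
  by move=> vy; apply: generated_mem; rewrite mem_cat map_f ?orbT.
have Yy h v : h \in s -> v \in Y h -> v \in y.
  by move=> hs vh; apply/flattenP; exists (Y h); rewrite ?map_f.
have ct h lam mu : h \in s -> generated t (coeff lam mu h).
  move=> hs; apply: (vspan_generated (s := Y h)) (proj1 (YP h) lam mu).
  by move=> x /(Yy _ _ hs) /yt.
have cSt h lam mu : h \in s -> generated t (S (coeff lam mu h)).
  move=> hs; apply: (vspan_generated (s := Y h)
    (T := preim_subalg S (generated t))) (proj1 (YP h) lam mu).
  by move=> x /(Yy _ _ hs) /St.
have yE v : v \in y -> exists h lam mu, h \in s /\ v = coeff lam mu h.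
  case/flattenP => _ /mapP[h hs ->] vh.
  by have [lam [mu ->]] := proj2 (YP h) v vh; exists h, lam, mu.
split; last by move=> h hs; rewrite -[h]coeff_counit; apply: ct.
split=> h; last first.
  apply: (generated_min (T := preim_subalg S (generated t))) => x.
  rewrite mem_cat => /orP[/St //|/mapP[v vy ->]] /=.
  by rewrite antipodeK; apply: yt.
apply: (generated_min
  (T := preim_subalg Delta (tens_subalg (generated t) (generated t)))) => x.
rewrite mem_cat => /orP[/yE|/mapP[v /yE]].
  move=> [h0 [lam [mu [hs ->]]]]; split=> nu.
    by rewrite rslice_coeff; apply: ct.
  by rewrite lslice_coeff; apply: ct.
move=> [h0 [lam [mu [hs ->]]]] ->; split=> nu.
  by rewrite rslice_comul_antipode lslice_coeff; apply: cSt.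
by rewrite lslice_comul_antipode rslice_coeff; apply: cSt.
Qed.
End HopfSubalgebras.

(** * The translation map of a torsor *)

Lemma copair_nat (k : fieldType) (A B R S : comAlgType k)
    (f : {lrmorphism R -> S}) (x : {lrmorphism A -> R}) (y : {lrmorphism B -> R}) t :
  f (copair x y t) = copair (f \oR x) (f \oR y) t.
Proof.
apply: (tens_hom_ext (f := f \o copair x y) (g := copair (f \oR x) (f \oR y))) => a /=.
  by rewrite !copair_left.
by rewrite !copair_right.
Qed.

Section Translation.
Variables (k : fieldType) (G : affGroup k) (A : comAlgType k).
Variable a : action G (Spec A).
Hypothesis aT : is_torsor a.
Notation H := (gring G).
Notation rho := (coact a).
Notation Delta := (comul G).
Notation S := (antipode G).

Lemma torsor_inj (R : comAlgType k) (x : {lrmorphism A -> R})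
  (g g' : {lrmorphism H -> R}) : act_on a x g = act_on a x g' -> g = g'.
Proof.
move=> e; have /bij_inj inj := aT.2 R.
have : (x, g) = (x, g') by apply: inj; congr pair; exact: e.
by case.
Qed.

(** The torsor map is surjective at the universal pair of points, over
    A (x) A. *)
Lemma translation_exists : exists tau : {lrmorphism H -> tens A A},
  act_on a tleft tau = tright.
Proof.
have [inv _ invK] := aT.2 (tens A A).
have := invK (tleft : {lrmorphism A -> tens A A}, tright : {lrmorphism A -> tens A A}).
case: (inv _) => x g [-> e].
by exists g.
Qed.

Definition translation : {lrmorphism H -> tens A A} := sval (cid translation_exists).
Notation tau := translation.

Lemma act_translation : act_on a tleft tau = tright.
Proof. by rewrite /translation; case: cid. Qed.

Definition translate (R : comAlgType k) (x y : {lrmorphism A -> R}) :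
  {lrmorphism H -> R} := copair x y \oR tau.

Lemma act_on_nat (R T : comAlgType k) (f : {lrmorphism R -> T})
    (x : {lrmorphism A -> R}) (g : {lrmorphism H -> R}) :
  act_on a (f \oR x) (f \oR g) = f \oR act_on a x g.
Proof. apply: lrmorphism_ext => u.
by rewrite [RHS]hcompE [LHS]act_onE [in RHS]act_onE copair_nat.
Qed.

Lemma act_translate (R : comAlgType k) (x y : {lrmorphism A -> R}) :
  act_on a x (translate x y) = y.
Proof.
have := act_on_nat (copair x y) tleft tau.
rewrite act_translation.
have -> : copair x y \oR tleft = x :> {lrmorphism A -> R}.
  by apply: lrmorphism_ext => b /=; rewrite copair_left.
move=> ->; apply: lrmorphism_ext => b /=; by rewrite copair_right.
Qed.

Lemma translate_unique (R : comAlgType k) (x y : {lrmorphism A -> R}) g :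
  act_on a x g = y -> g = translate x y.
Proof. by move=> e; apply: (@torsor_inj _ x); rewrite act_translate. Qed.

(** This is tau(x, y.g) = tau(x, y) g at the universal triple: both sides move
    x to y.g. *)
Lemma translation_comul h :
  assoc (tmap idfun rho (tau h)) = tmap tau idfun (Delta h).
Proof.
pose x : {lrmorphism A -> tens (tens A A) H} := tleft \oR tleft.
pose y : {lrmorphism A -> tens (tens A A) H} := tleft \oR tright.
pose g : {lrmorphism H -> tens (tens A A) H} := tright.
have yE b : act_on a y g b = copair (tleft \oR tright) tright (rho b).
  by rewrite act_onE.
have lE t : assoc (tmap idfun rho t) = copair x (act_on a y g) t.
  apply: (tens_hom_ext (f := @assoc _ A A H \o tmap idfun rho)
    (g := copair x (act_on a y g))) => b.
    by rewrite /= /tmap !copair_left /= /assoc copair_left.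
  by rewrite /= /tmap !copair_right /= yE /assoc copair_right.
have rE t : tmap tau idfun t = copair (tleft \oR tau) g t.
  apply: (tens_hom_ext (f := tmap tau idfun) (g := copair (tleft \oR tau) g)) => b.
    by rewrite /= /tmap !copair_left.
  by rewrite /= /tmap !copair_right.
rewrite lE rE -gmulE -/(translate _ _ _).
have e : gmul (tleft \oR tau : {lrmorphism H -> tens (tens A A) H}) g =
    translate x (act_on a y g).
  apply: translate_unique.
  by rewrite act_onM act_on_nat act_translation.
by rewrite e.
Qed.

(** This is tau(y, x) = tau(x, y)^-1 at the universal pair. *)
Lemma translation_swap h : tswap (tau h) = tau (S h).
Proof.
rewrite -ginvE.
pose l : {lrmorphism A -> tens A A} := tleft.
pose r : {lrmorphism A -> tens A A} := tright.
have -> : (ginv (tau : {lrmorphism H -> tens A A}) : {lrmorphism H -> tens A A}) = translate r l.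
  apply: translate_unique; rewrite -[r]act_translation.
  by rewrite -act_onM gmulgV act_on1.
by [].
Qed.

Lemma lslice_coact_translation (lam nu : {linear A -> k^o}) h :
  lslice nu (rho (lslice lam (tau h))) = lslice (nu \o lslice lam \o tau) (Delta h).
Proof.
rewrite -(lslice_tmap idfun rho) /= -lslice_assoc translation_comul.
by rewrite (lslice_tmap tau idfun).
Qed.

Lemma rslice_translation (mu : {linear A -> k^o}) h :
  rslice mu (tau h) = lslice mu (tau (S h)).
Proof. by rewrite -translation_swap lslice_swap. Qed.
End Translation.

(** * Functions on a quotient of the torsor *)

Section Invariants.
Variables (k : fieldType) (G : affGroup k) (A : comAlgType k).
Variable a : action G (Spec A).
Hypothesis aT : is_torsor a.
Notation H := (gring G).
Notation rho := (coact a).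
Notation Delta := (comul G).
Notation tau := (translation aT).

Definition full_subalg (B : comAlgType k) : subalg B.
Proof. by apply: (@Subalg _ _ (fun=> True)). Defined.

Section OneHopf.
Variable P : subalg H.

(** The functions on the quotient of X by the kernel of G -> Spec P. *)
Definition invariants : subalg A := preim_subalg rho (tens_subalg (full_subalg A) P).

Lemma invariantsP u : (forall lam, P (lslice lam (rho u))) -> invariants u.
Proof. by split. Qed.

Hypothesis hopfP : is_hopf P.

(** Left slices of rho lie in [P] by definition.  For the right ones, a left
    slice of their coaction is a right slice of Delta at an element of [P]. *)
Lemma invariants_coact u : invariants u -> in_tens invariants P (rho u).
Proof.
move=> [_ uP]; split=> // mu; apply: invariantsP => lam.
rewrite lslice_rslice_coact; apply: (proj1 (hopfP.1 _ _)).
exact: uP.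
Qed.

(** By [lslice_coact_translation], the coaction on a left slice of tau(h) has its
    left slices among those of Delta h.  The right slices of tau(h) are left
    slices of tau(S h). *)
Lemma invariants_translation h : P h -> in_tens invariants invariants (tau h).
Proof.
have main g : P g -> forall lam, invariants (lslice lam (tau g)).
  move=> Pg lam; apply: invariantsP => nu.
  rewrite lslice_coact_translation; apply: (proj2 (hopfP.1 _ _)).
  exact: Pg.
move=> Ph; split=> mu; last exact: main.
by rewrite rslice_translation; apply: main; apply: hopfP.2.
Qed.
End OneHopf.

Lemma invariants_mono (P P' : subalg H) :
  (forall h, P h -> P' h) -> forall u, invariants P u -> invariants P' u.
Proof. by move=> PP' u [_ uP]; apply: invariantsP => lam; apply: PP'. Qed.

(** The algebra is generated by the components of tau at the generators [t]. *)
Lemma invariants_fg (t : seq H) : is_hopf (generated t) ->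
  exists s : seq A, forall u, invariants (generated t) u <-> generated s u.
Proof.
set P := generated t => hopfP.
have subP := sa_subspace (invariants P).
have /choice[s sE] (h : H) : exists s : seq A, P h ->
    (forall u, u \in s -> invariants P u) /\
    tens_subalg (generated s) (generated s) (tau h).
  have [Ph|nPh] := pselect (P h); last by exists [::].
  have [n [b [c [bP cP ->]]]] := in_tens_expand subP (invariants_translation hopfP Ph).
  exists ([seq b i | i <- index_iota 0 n] ++ [seq c i | i <- index_iota 0 n]) => _.
  split=> [u|].
    by rewrite mem_cat => /orP[] /mapP[i _ ->].
  apply: subspace_sum_ord => [|i]; first exact: sa_subspace.
  apply: in_tens_pure; try exact: sa_subspace; apply: generated_mem;
    by rewrite mem_cat map_f ?orbT // mem_index_iota /=.
pose s' := flatten [seq s h | h <- t].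
exists s' => u; split; last first.
  apply: generated_min => x /flattenP[_ /mapP[h ht ->]].
  by apply: (proj1 (sE h _)); apply: generated_mem.
have tauP h : P h -> tens_subalg (generated s') (generated s') (tau h).
  apply: (generated_min
    (T := preim_subalg tau (tens_subalg (generated s') (generated s')))) => x xt.
  have sub y : generated (s x) y -> generated s' y.
    apply: generated_min => z zs; apply: generated_mem.
    by apply/flattenP; exists (s x); rewrite ?map_f.
  have [ur ul] := (proj2 (sE x (generated_mem xt))).
  by split=> ?; apply: sub.
move=> /(in_tens_expand (sa_subspace (full_subalg A)))[n [b [h [_ hP rhoE]]]].
have [lam lam1] := linear_form_eq1 (oner_neq0 A).
(* the relation y = x.tau(x, y) read on the function [u] of y *)
have uE : tright u = \sum_(i < n) tleft (b i) * tau (h i) :> tens A A.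
  have -> : tright u = copair tleft tau (rho u) by rewrite -act_onE act_translation.
  by rewrite rhoE linear_sum; apply: eq_bigr => i _ /=; rewrite copair_pure.
have -> : u = lslice lam (tright u) by rewrite lslice_pure lam1 scale1r.
suff : tens_subalg (full_subalg A) (generated s') (tright u) by case.
rewrite uE; apply: subspace_sum_ord => [|i]; first exact: sa_subspace.
apply: saM; last by have [_ ?] := tauP _ (hP i); split.
by apply: in_tens_pure; try exact: sa_subspace; try exact: sa1.
Qed.
End Invariants.

(** * The quotient group *)

Lemma hcomp_injl (k : fieldType) (A B C : comAlgType k) (J : {lrmorphism B -> C})
    (f g : {lrmorphism A -> B}) :
  injective J -> J \oR f = J \oR g :> {lrmorphism A -> C} -> f = g.
Proof.
move=> JI e; apply: lrmorphism_ext => a; apply: JI.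
exact: (congr1 (fun h : {lrmorphism A -> C} => h a) e).
Qed.

(** Points with values in [R] on spectra of subalgebras come from the universal
    ones, over A' (x) B' (x) C'.  This ring embeds in A (x) B (x) C, where the
    universal points extend to the larger algebras.  So natural identities
    descend from A, B, C to A', B', C'. *)
Lemma universal_points (k : fieldType) (A B C A' B' C' R : comAlgType k)
    (i : {lrmorphism A' -> A}) (j : {lrmorphism B' -> B}) (l : {lrmorphism C' -> C})
    (x : {lrmorphism A' -> R}) (y : {lrmorphism B' -> R}) (z : {lrmorphism C' -> R}) :
  injective i -> injective j -> injective l ->
  exists (U U' : comAlgType k) (r : {lrmorphism U -> R}) (J : {lrmorphism U -> U'})
    (x0 : {lrmorphism A' -> U}) (y0 : {lrmorphism B' -> U}) (z0 : {lrmorphism C' -> U})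
    (X : {lrmorphism A -> U'}) (Y : {lrmorphism B -> U'}) (Z : {lrmorphism C -> U'}),
    [/\ injective J, [/\ x = r \oR x0, y = r \oR y0 & z = r \oR z0] &
        [/\ J \oR x0 = X \oR i :> {lrmorphism _ -> _},
            J \oR y0 = Y \oR j :> {lrmorphism _ -> _} &
            J \oR z0 = Z \oR l :> {lrmorphism _ -> _}]].
Proof.
move=> iI jI lI.
exists (tens (tens A' B') C'), (tens (tens A B) C), (copair (copair x y) z),
  (tmap (tmap i j) l), (tleft \oR tleft), (tleft \oR tright), tright,
  (tleft \oR tleft), (tleft \oR tright), tright.
split; first by apply: tmap_inj => //; apply: tmap_inj.
  split; apply: lrmorphism_ext => a /=; rewrite ?copair_left ?copair_right //=;
  by rewrite ?copair_left ?copair_right.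
split; apply: lrmorphism_ext => a /=; rewrite ?tmap_left ?tmap_right //=;
  by rewrite ?tmap_left ?tmap_right.
Qed.

Section SubHopf.
Variables (k : fieldType) (G : affGroup k) (P : subalg (gring G)).
Hypothesis hopfP : is_hopf P.
Notation H := (gring G).
Notation H' := (subalg_of P).
Notation inc := (@sincl k H P).

Lemma sub_comul_exists : exists f : {lrmorphism H' -> tens H' H'},
  forall h, tmap inc inc (f h) = comul G (inc h).
Proof.
apply: (tens_corestrict (f := comul G \oR inc)) => h.
by apply: hopfP.1; apply: sinclP.
Qed.

Lemma sub_antipode_exists : exists f : {lrmorphism H' -> H'},
  forall h, inc (f h) = antipode G (inc h).
Proof.
apply: (corestrict (f := antipode G \oR inc)) => h.
by apply: hopfP.2; apply: sinclP.
Qed.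

Definition sub_comul : {lrmorphism H' -> tens H' H'} := sval (cid sub_comul_exists).
Definition sub_antipode : {lrmorphism H' -> H'} := sval (cid sub_antipode_exists).

Lemma sub_comulE h : tmap inc inc (sub_comul h) = comul G (inc h).
Proof. by rewrite /sub_comul; case: cid. Qed.
Lemma sub_antipodeE h : inc (sub_antipode h) = antipode G (inc h).
Proof. by rewrite /sub_antipode; case: cid. Qed.

Definition qmul (R : comAlgType k) (x y : {lrmorphism H' -> R}) : {lrmorphism H' -> R} :=
  copair x y \oR sub_comul.
Definition qone (R : comAlgType k) : {lrmorphism H' -> R} :=
  (gone G R : {lrmorphism H -> R}) \oR inc.
Definition qinv (R : comAlgType k) (x : {lrmorphism H' -> R}) : {lrmorphism H' -> R} :=
  x \oR sub_antipode.

Lemma qmul_nat (R T : comAlgType k) (f : {lrmorphism R -> T}) (x y : {lrmorphism H' -> R}) :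
  f \oR qmul x y = qmul (f \oR x) (f \oR y).
Proof. by apply: lrmorphism_ext => h /=; rewrite copair_nat. Qed.

Lemma qmul_restrict (R : comAlgType k) (x y : {lrmorphism H -> R}) :
  qmul (x \oR inc) (y \oR inc) = (gmul x y : {lrmorphism H -> R}) \oR inc.
Proof.
apply: lrmorphism_ext => h /=; rewrite gmulE -sub_comulE.
apply: (tens_hom_ext (f := copair (x \oR inc) (y \oR inc))
  (g := copair x y \o tmap inc inc)) => b /=.
  by rewrite /tmap !copair_left.
by rewrite /tmap !copair_right.
Qed.

Lemma qone_nat (R T : comAlgType k) (f : {lrmorphism R -> T}) :
  f \oR qone R = qone T.
Proof. by rewrite /qone -(gone_nat G f); apply: lrmorphism_ext. Qed.

Lemma qmulA (R : comAlgType k) (x y z : {lrmorphism H' -> R}) :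
  qmul x (qmul y z) = qmul (qmul x y) z.
Proof.
have incI := @sincl_inj _ _ P.
have [U [U' [r [J [x0 [y0 [z0 [X [Y [Z [JI [-> -> ->] [xE yE zE]]]]]]]]]]]] :=
  universal_points x y z incI incI incI.
rewrite -!qmul_nat; congr (_ \oR _).
apply: (hcomp_injl JI); rewrite !qmul_nat xE yE zE !qmul_restrict.
by rewrite gmulA.
Qed.

Lemma qmul1 (R : comAlgType k) (x : {lrmorphism H' -> R}) : qmul (qone R) x = x.
Proof.
have incI := @sincl_inj _ _ P.
have [U [U' [r [J [x0 [_ [_ [X [_ [_ [JI [-> _ _] [xE _ _]]]]]]]]]]]] :=
  universal_points x x x incI incI incI.
rewrite -(qone_nat r) -!qmul_nat; congr (_ \oR _).
apply: (hcomp_injl JI); rewrite !qmul_nat xE qone_nat qmul_restrict.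
by rewrite gmul1g.
Qed.

Lemma qmulV (R : comAlgType k) (x : {lrmorphism H' -> R}) : qmul (qinv x) x = qone R.
Proof.
have incI := @sincl_inj _ _ P.
have [U [U' [r [J [x0 [_ [_ [X [_ [_ [JI [-> _ _] [xE _ _]]]]]]]]]]]] :=
  universal_points x x x incI incI incI.
rewrite /qinv -hcompA -(qone_nat r) -!qmul_nat; congr (_ \oR _).
apply: (hcomp_injl JI); rewrite !qmul_nat xE qone_nat hcompA xE.
have -> : (X \oR inc) \oR sub_antipode = (ginv X : {lrmorphism H -> U'}) \oR inc :> {lrmorphism H' -> U'}.
  by apply: lrmorphism_ext => h /=; rewrite sub_antipodeE ginvE.
by rewrite qmul_restrict gmulVg.
Qed.

Definition quotient_group : affGroup k :=
  @AffGroup k H' (fun R x y => qmul x y) (fun R => qone R) (fun R x => qinv x)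
    (fun R x y z => qmulA x y z) (fun R x => qmul1 x) (fun R x => qmulV x)
    (fun R T f x y => qmul_nat f x y).
End SubHopf.

(** * The quotient torsor and its centralizer *)

Section QuotientSpace.
Variables (k : fieldType) (G : affGroup k) (A : comAlgType k).
Variable a : action G (Spec A).
Hypothesis aT : is_torsor a.
Notation H := (gring G).
Variable P : subalg H.
Hypothesis hopfP : is_hopf P.
Notation H' := (subalg_of P).
Notation A' := (subalg_of (invariants a P)).
Notation incH := (@sincl k H P).
Notation incA := (@sincl k A (invariants a P)).
Notation Q := (quotient_group hopfP).

Lemma sub_coact_exists : exists f : {lrmorphism A' -> tens A' H'},
  forall u, tmap incA incH (f u) = coact a (incA u).
Proof.
apply: (tens_corestrict (f := coact a \oR incA)) => u.
by apply: invariants_coact => //; apply: sinclP.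
Qed.

Lemma sub_translation_exists : exists f : {lrmorphism H' -> tens A' A'},
  forall h, tmap incA incA (f h) = translation aT (incH h).
Proof.
apply: (tens_corestrict (f := translation aT \oR incH)) => h.
by apply: invariants_translation => //; apply: sinclP.
Qed.

Definition sub_coact : {lrmorphism A' -> tens A' H'} := sval (cid sub_coact_exists).
Definition sub_translation : {lrmorphism H' -> tens A' A'} :=
  sval (cid sub_translation_exists).

Lemma sub_coactE u : tmap incA incH (sub_coact u) = coact a (incA u).
Proof. by rewrite /sub_coact; case: cid. Qed.
Lemma sub_translationE h :
  tmap incA incA (sub_translation h) = translation aT (incH h).
Proof. by rewrite /sub_translation; case: cid. Qed.

Definition qact (R : comAlgType k) (x : {lrmorphism A' -> R}) (g : {lrmorphism H' -> R}) :
  {lrmorphism A' -> R} := copair x g \oR sub_coact.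
Definition qtranslate (R : comAlgType k) (x y : {lrmorphism A' -> R}) :
  {lrmorphism H' -> R} := copair x y \oR sub_translation.

Lemma qact_nat (R T : comAlgType k) (f : {lrmorphism R -> T}) x g :
  f \oR qact x g = qact (f \oR x) (f \oR g).
Proof. by apply: lrmorphism_ext => h /=; rewrite copair_nat. Qed.

Lemma qtranslate_nat (R T : comAlgType k) (f : {lrmorphism R -> T}) x y :
  f \oR qtranslate x y = qtranslate (f \oR x) (f \oR y).
Proof. by apply: lrmorphism_ext => h /=; rewrite copair_nat. Qed.

Lemma copair_restrict (B C B' C' R : comAlgType k)
    (i : {lrmorphism B' -> B}) (j : {lrmorphism C' -> C})
    (x : {lrmorphism B -> R}) (y : {lrmorphism C -> R}) t :
  copair (x \oR i) (y \oR j) t = copair x y (tmap i j t).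
Proof.
apply: (tens_hom_ext (f := copair (x \oR i) (y \oR j)) (g := copair x y \o tmap i j)) => b /=.
  by rewrite /tmap !copair_left.
by rewrite /tmap !copair_right.
Qed.

Lemma qact_restrict (R : comAlgType k) (x : {lrmorphism A -> R}) (g : {lrmorphism H -> R}) :
  qact (x \oR incA) (g \oR incH) = act_on a x g \oR incA.
Proof.
by apply: lrmorphism_ext => u /=; rewrite act_onE copair_restrict sub_coactE.
Qed.

Lemma qtranslate_restrict (R : comAlgType k) (x y : {lrmorphism A -> R}) :
  qtranslate (x \oR incA) (y \oR incA) = translate aT x y \oR incH.
Proof.
by apply: lrmorphism_ext => u /=; rewrite copair_restrict sub_translationE.
Qed.

Lemma qact1 (R : comAlgType k) (x : {lrmorphism A' -> R}) : qact x (qone P R) = x.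
Proof.
have incI := @sincl_inj _ _ (invariants a P).
have [U [U' [r [J [x0 [_ [_ [X [_ [_ [JI [-> _ _] [xE _ _]]]]]]]]]]]] :=
  universal_points x x x incI incI incI.
rewrite -(qone_nat P r) -!qact_nat; congr (_ \oR _).
apply: (hcomp_injl JI); rewrite !qact_nat xE qone_nat qact_restrict.
by congr (_ \oR _); apply: act_on1.
Qed.

Lemma qactM (R : comAlgType k) (x : {lrmorphism A' -> R}) (g h : {lrmorphism H' -> R}) :
  qact x (qmul hopfP g h) = qact (qact x g) h.
Proof.
have incAI := @sincl_inj _ _ (invariants a P).
have incHI := @sincl_inj _ _ P.
have [U [U' [r [J [x0 [g0 [h0 [X [g' [h' [JI [-> -> ->] [xE gE hE]]]]]]]]]]]] :=
  universal_points x g h incAI incHI incHI.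
rewrite -qmul_nat -!qact_nat; congr (_ \oR _).
apply: (hcomp_injl JI); rewrite !qact_nat qmul_nat xE gE hE qmul_restrict !qact_restrict.
by congr (_ \oR _); apply: act_onM.
Qed.

Lemma qact_translate (R : comAlgType k) (x y : {lrmorphism A' -> R}) :
  qact x (qtranslate x y) = y.
Proof.
have incI := @sincl_inj _ _ (invariants a P).
have [U [U' [r [J [x0 [y0 [_ [X [Y [_ [JI [-> -> _] [xE yE _]]]]]]]]]]]] :=
  universal_points x y y incI incI incI.
rewrite -qtranslate_nat -!qact_nat; congr (_ \oR _).
apply: (hcomp_injl JI).
by rewrite qact_nat qtranslate_nat xE yE qtranslate_restrict qact_restrict act_translate.
Qed.

Lemma qtranslate_act (R : comAlgType k) (x : {lrmorphism A' -> R}) (g : {lrmorphism H' -> R}) :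
  qtranslate x (qact x g) = g.
Proof.
have incAI := @sincl_inj _ _ (invariants a P).
have incHI := @sincl_inj _ _ P.
have [U [U' [r [J [x0 [g0 [_ [X [g' [_ [JI [-> -> _] [xE gE _]]]]]]]]]]]] :=
  universal_points x g g incAI incHI incHI.
rewrite -qact_nat -!qtranslate_nat; congr (_ \oR _).
apply: (hcomp_injl JI).
rewrite qtranslate_nat qact_nat xE gE qact_restrict qtranslate_restrict.
by congr (_ \oR _); apply/esym/translate_unique.
Qed.

Definition quotient_action : action Q (Spec A') :=
  @Action k Q (Spec A') (fun R x g => qact x g) (fun R x => qact1 x)
    (fun R x g h => qactM x g h) (fun R T f x g => qact_nat f x g).

(** The restricted translation map gives the inverse of (x, g) |-> (x, x.g). *)
Lemma quotient_torsor : is_torsor quotient_action.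
Proof.
split; first by exists A'; split; apply: (idfun : {lrmorphism A' -> A'}).
move=> R.
exists (fun xy : {lrmorphism A' -> R} * {lrmorphism A' -> R} => (xy.1, qtranslate xy.1 xy.2)) => [[x g]|[x y]].
  by congr pair; apply: qtranslate_act.
by congr pair; apply: qact_translate.
Qed.

Lemma quotient_act1 (R : comAlgType k) (x : Spec A' R) :
  qact x (spec_hom incH (gone G R)) = x.
Proof. exact: qact1. Qed.

Lemma quotient_actM (R : comAlgType k) (x : Spec A' R) (g h : gpts G R) :
  qact x (spec_hom incH (gmul g h)) = qact (qact x (spec_hom incH g)) (spec_hom incH h).
Proof. by rewrite -qactM; congr qact; apply/esym/qmul_restrict. Qed.

Lemma quotient_act_nat (R T : comAlgType k) (f : {lrmorphism R -> T})
    (x : Spec A' R) (g : gpts G R) :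
  spec_map f (qact x (spec_hom incH g)) = qact (spec_map f x) (spec_hom incH (spec_map f g)).
Proof.
apply: etrans (qact_nat f x (g \oR incH)) _.
by rewrite hcompA.
Qed.

Definition quotient_space : affSpace G :=
  @AffSpace k G A' (@Action k G (Spec A') (fun R x g => qact x (spec_hom incH g))
    (fun R x => quotient_act1 x) (fun R x g h => quotient_actM x g h)
    (fun R T f x g => quotient_act_nat f x g)).

Lemma tleft_inj (B C : comAlgType k) : injective (@tleft k B C).
Proof.
have [mu mu1] := linear_form_eq1 (oner_neq0 C).
move=> b b' /(congr1 (rslice mu)).
by rewrite !rslice_pure mu1 !scale1r.
Qed.

(** If [g] centralizes, it fixes the universal point over R (x) A'.  The action
    is free, so [g] becomes trivial over R (x) A', in which R embeds. *)
Lemma quotient_kernel (R : comAlgType k) (g : gpts G R) :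
  spec_hom incH g = gone Q R <-> @centralizer k G quotient_space R g.
Proof.
split=> [e R' f x|gC].
  change (qact x (spec_hom incH (spec_map f g)) = x).
  have -> : spec_hom incH (spec_map f g) = f \oR spec_hom incH g.
    exact: lrmorphism_ext.
  rewrite e; change (qact x (f \oR qone P R) = x).
  by rewrite qone_nat qact1.
have := gC (tens R A') tleft tright.
change (qact tright (spec_hom incH (spec_map tleft g)) = tright -> spec_hom incH g = gone Q R).
move=> e.
have e' : spec_hom incH (spec_map tleft g) = qone P (tens R A').
  by rewrite -[LHS](qtranslate_act tright) e -{2}(qact1 tright) qtranslate_act.
apply: (hcomp_injl (@tleft_inj R A')).
change (tleft \oR spec_hom incH g = tleft \oR qone P R :> {lrmorphism H' -> tens R A'}).
by rewrite qone_nat -e'; apply: lrmorphism_ext.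
Qed.

Lemma quotient_torsor_mod_centralizer : torsor_mod_centralizer quotient_space.
Proof.
exists Q, incH, quotient_action; split=> //.
  split; [|exact: sincl_inj|exact: quotient_kernel].
  by move=> R g h; apply/esym/qmul_restrict.
exact: quotient_torsor.
Qed.

End QuotientSpace.

(** * Finite type *)

Section PolynomialQuotient.
Variables (k : fieldType) (B : comAlgType k) (n : nat) (b : 'I_n -> B).

Definition peval (p : {mpoly k[n]}) : B := mmap (in_alg B) b p.

Lemma peval_linear : linear peval.
Proof. by move=> c p q; rewrite /peval mmapD mmapZ /= -scalerAl mul1r. Qed.

Lemma peval_monoid : monoid_morphism peval.
Proof. by split; rewrite /peval ?rmorph1 // => p q; rewrite rmorphM. Qed.

HB.instance Definition _ :=
  GRing.isLinear.Build k {mpoly k[n]} B *:%R peval peval_linear.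
HB.instance Definition _ :=
  GRing.isMonoidMorphism.Build {mpoly k[n]} B peval peval_monoid.

Lemma pevalX i : peval 'X_i = b i.
Proof. by rewrite /peval mmapX mmap1U. Qed.
End PolynomialQuotient.

(** The image of the polynomial ring in the generators is a subalgebra that
    contains them. *)
Lemma generated_finitely_generated (k : fieldType) (A : comAlgType k)
    (S : subalg A) (s : seq A) :
  (forall a, S a <-> generated s a) -> finitely_generated (subalg_of S).
Proof.
move=> SE.
have sS (i : 'I_(size s)) : S (tnth (in_tuple s) i).
  by apply/SE/generated_mem; apply: mem_tnth.
have /choice[b bE] i := sincl_onto (sS i).
exists (size s), (peval b) => u.
have := sinclP u; rewrite SE; pose f : {lrmorphism _ -> A} := sincl \oR peval b.
have T0 : subspace (fun x => exists p, f p = x).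
  split=> [|c _ _ [p <-] [q <-]]; first by exists 0; rewrite linear0.
  by exists (c *: p + q); rewrite linearP.
have T1 : exists p, f p = 1 by exists 1; rewrite rmorph1.
have TM x y : (exists p, f p = x) -> (exists p, f p = y) -> exists p, f p = x * y.
  by move=> [p <-] [q <-]; exists (p * q); rewrite rmorphM.
case/(generated_min (T := Subalg T0 T1 TM)) => [x xs|p /sincl_inj pE]; last by exists p.
have xi : (index x s < size s)%N by rewrite index_mem.
exists 'X_(Ordinal xi); rewrite /f /= pevalX bE (tnth_nth 0) /=.
exact: nth_index.
Qed.

(** * The projective limit *)

Section Glue.
Variables (k : fieldType) (A R : comAlgType k) (I : Type) (T : I -> subalg A).
Variable f : forall i, {lrmorphism subalg_of (T i) -> R}.
Hypothesis T_directed : forall i j, exists l,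
  (forall a, T i a -> T l a) /\ (forall a, T j a -> T l a).
Hypothesis T_cover : forall a, exists i, T i a.
Hypothesis f_compat : forall i j (u : subalg_of (T i)) (v : subalg_of (T j)),
  sincl u = sincl v -> f i u = f j v.

(** Any two elements lie in a common member of the family, where additivity and
    multiplicativity can be read off. *)
Lemma glue_homs : exists g : {lrmorphism A -> R},
  forall i (u : subalg_of (T i)), g (sincl u) = f i u.
Proof.
have /choice[g gE] a : exists r : R,
    forall i (u : subalg_of (T i)), sincl u = a -> f i u = r.
  have [i /sincl_onto[u uE]] := T_cover a.
  by exists (f i u) => j v vE; apply: f_compat; rewrite vE.
have common a b : exists i (u v : subalg_of (T i)), sincl u = a /\ sincl v = b.
  have [i Ta] := T_cover a; have [j Tb] := T_cover b.
  have [l [il jl]] := T_directed i j.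
  have [u uE] := sincl_onto (il _ Ta); have [v vE] := sincl_onto (jl _ Tb).
  by exists l, u, v.
have glin : linear g.
  move=> c a b; have [i [u [v [ua vb]]]] := common a b.
  rewrite -(gE a i u) // -(gE b i v) //.
  by rewrite -(gE _ i (c *: u + v)) ?linearP //= ua vb.
have gmon : monoid_morphism g.
  split=> [|a b].
    have [i [u _]] := common 0 0.
    by rewrite -(gE _ i 1) ?rmorph1.
  have [i [u [v [ua vb]]]] := common a b.
  rewrite -(gE a i u) // -(gE b i v) //.
  by rewrite -(gE _ i (u * v)) ?rmorphM //= ua vb.
exists (HB.pack_for {lrmorphism A -> R} g
  (GRing.isLinear.Build k A R *:%R g glin)
  (GRing.isMonoidMorphism.Build A R g gmon)) => i u /=.
exact/esym/gE.
Qed.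
End Glue.

Section Limit.
Variables (k : fieldType) (G : affGroup k) (X : affSpace G).
Notation H := (gring G).
Notation A := (oring X).

Definition hopf_index := {t : seq H | is_hopf (generated t)}.
Definition hopf_le (i j : hopf_index) : Prop :=
  forall h, generated (sval i) h -> generated (sval j) h.

Lemma hopf_index_above (s : seq H) :
  exists l : hopf_index, forall h, h \in s -> generated (sval l) h.
Proof.
by have [t [hopft st]] := fg_hopf_subalgebra s; exists (exist _ t hopft).
Qed.

Lemma hopf_directed i j : exists l, hopf_le i l /\ hopf_le j l.
Proof.
have [l lE] := hopf_index_above (sval i ++ sval j); exists l.
by split=> h; apply: generated_min => x xs; apply: lE; rewrite mem_cat xs ?orbT.
Qed.

Lemma hopf_index_inhabited : inhabited hopf_index.
Proof. by have [l _] := hopf_index_above [::]; split. Qed.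

Definition hopf_directedSet : directedSet :=
  @DirectedSet hopf_index hopf_le (fun i h => id)
    (fun i j l ij jl h ih => jl h (ij h ih)) hopf_directed hopf_index_inhabited.

Notation I := hopf_directedSet.
Notation inv i := (invariants (oact X) (generated (sval (i : hopf_index)))).

Definition stage (i : I) : affSpace G := quotient_space (oact X) (svalP i).

(** An expansion of rho u has finitely many right components; any index whose
    Hopf subalgebra contains them will do. *)
Lemma invariants_cover u : exists i : I, inv i u.
Proof.
have [n [b [h [_ _ rhoE]]]] := in_tens_expand (P := full_subalg A) (Q := full_subalg H) (t := coact (oact X) u)
  (sa_subspace (full_subalg A)) (conj (fun=> Logic.I) (fun=> Logic.I)).
have [i iP] := hopf_index_above [seq h l | l <- index_iota 0 n].
exists i; apply: invariantsP => lam; rewrite rhoE linear_sum.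
apply: (subspace_sum_ord (W := generated (sval i))) => [|l /=].
  exact: sa_subspace.
rewrite lslice_pure; apply: (subalgZ (S := generated (sval i))).
by apply: iP; rewrite map_f // mem_index_iota /=.
Qed.

Lemma stage_inc_exists (i j : I) (ij : dle i j) :
  exists f : {lrmorphism subalg_of (inv i) -> subalg_of (inv j)},
    forall u, sincl (f u) = sincl u.
Proof.
apply: corestrict => u; apply: invariants_mono ij _ _.
exact: sinclP.
Qed.

Definition stage_inc (i j : I) (ij : dle i j) :
  {lrmorphism subalg_of (inv i) -> subalg_of (inv j)} :=
  sval (cid (stage_inc_exists ij)).

Lemma stage_incE (i j : I) (ij : dle i j) u : sincl (stage_inc ij u) = sincl u.
Proof. by rewrite /stage_inc; case: cid. Qed.

(** The inclusions are equivariant because they are so inside A; a point of the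
    larger stage need not extend to A, whence the passage through universal
    points. *)
Lemma qact_stage_inc (i j : I) (ij : dle i j) (R : comAlgType k)
    (x : {lrmorphism subalg_of (inv j) -> R}) (g : {lrmorphism H -> R}) :
  qact (svalP j) x (g \oR sincl) \oR stage_inc ij =
  qact (svalP i) (x \oR stage_inc ij) (g \oR sincl).
Proof.
have incI := @sincl_inj _ _ (inv j).
have idI : injective (idfun : {lrmorphism H -> H}) by move=> u v.
have [U [U' [r [J [x0 [g0 [_ [Y [g' [_ [JI [-> -> _] [xE gE _]]]]]]]]]]]] :=
  universal_points x g g incI idI idI.
have {}gE : J \oR g0 = g' by rewrite gE; apply: lrmorphism_ext.
have incE : sincl \oR stage_inc ij = sincl.
  by apply: lrmorphism_ext => u; rewrite hcompE stage_incE.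
rewrite -![r \oR g0 \oR _]hcompA -[r \oR x0 \oR _]hcompA -!qact_nat -[LHS]hcompA.
congr (_ \oR _); apply: (hcomp_injl JI).
rewrite [LHS]hcompA !qact_nat ![J \oR (g0 \oR _)]hcompA [J \oR (x0 \oR _)]hcompA gE xE.
by rewrite -[Y \oR _ \oR _]hcompA incE !qact_restrict -hcompA incE.
Qed.

Lemma stage_proj_act (i : I) (R : comAlgType k) (x : X R) (g : gpts G R) :
  spec_hom sincl (gact X R x g) = gact (stage i) R (spec_hom sincl x) g.
Proof. by apply/esym/qact_restrict. Qed.

Definition stage_proj (i : I) : gmorph X (stage i) :=
  @GMorph k G X (stage i) (fun R x => spec_hom sincl x)
    (fun R T f x => hcompA f x sincl) (fun R x g => @stage_proj_act i R x g).

Lemma stage_inc_act (i j : I) (ij : dle i j) (R : comAlgType k)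
    (x : stage j R) (g : gpts G R) :
  spec_hom (stage_inc ij) (gact (stage j) R x g) =
  gact (stage i) R (spec_hom (stage_inc ij) x) g.
Proof. exact: qact_stage_inc. Qed.

Definition stage_mor (i j : I) (ij : dle i j) : gmorph (stage j) (stage i) :=
  @GMorph k G (stage j) (stage i) (fun R x => spec_hom (stage_inc ij) x)
    (fun R T f x => hcompA f x (stage_inc ij)) (fun R x g => stage_inc_act ij x g).

Lemma stage_mor_id (i : I) (h : dle i i) (R : comAlgType k) (x : stage i R) :
  stage_mor h R x = x.
Proof.
apply: lrmorphism_ext => u /=; congr (_ _).
by apply: sincl_inj; rewrite stage_incE.
Qed.

Lemma stage_mor_comp (i j l : I) (ij : dle i j) (jl : dle j l) (il : dle i l)
    (R : comAlgType k) (x : stage l R) :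
  stage_mor ij R (stage_mor jl R x) = stage_mor il R x.
Proof.
apply: lrmorphism_ext => u /=; congr (_ _).
by apply: sincl_inj; rewrite !stage_incE.
Qed.

Definition stage_transition : transition (fun i : I => gspace_of_aff (stage i)) :=
  @Transition k G I (fun i : I => gspace_of_aff (stage i)) stage_mor
    stage_mor_id stage_mor_comp.

Lemma stage_cone : is_cone stage_transition stage_proj.
Proof.
move=> i j ij R y; apply: lrmorphism_ext => u /=; congr (_ _).
exact: stage_incE.
Qed.

Lemma stage_proj_joint_inj (R : comAlgType k) (x y : X R) :
  (forall i, stage_proj i R x = stage_proj i R y) -> x = y.
Proof.
move=> xy; apply: lrmorphism_ext => u.
have [i /sincl_onto[v <-]] := invariants_cover u.
exact: (congr1 (fun f : {lrmorphism oring (stage i) -> R} => f v) (xy i)).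
Qed.

(** A compatible family of points of the stages is a compatible family of
    morphisms on the algebras whose directed union is A. *)
Lemma cone_point (Y : gspace G) (q : forall i : I, gmorph Y (stage i)) :
  is_cone stage_transition q -> forall (R : comAlgType k) (y : Y R),
  exists x : X R, forall i, stage_proj i R x = q i R y.
Proof.
move=> qC R y.
have le_compat i j (ij : dle i j) (u : oring (stage i)) :
    (q i R y : {lrmorphism _ -> _}) u = (q j R y : {lrmorphism _ -> _}) (stage_inc ij u).
  by rewrite -(qC i j ij R y).
have [i j|||x xE] := @glue_homs k A R I (fun i => inv i) (fun i => q i R y).
- have [l [il jl]] := dle_directed i j.
  by exists l; split; apply: invariants_mono.
- exact: invariants_cover.
- move=> i j u v uv; have [l [il jl]] := dle_directed i j.
  rewrite (le_compat _ _ il) (le_compat _ _ jl); congr (_ _).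
  by apply: sincl_inj; rewrite !stage_incE.
by exists x => i; apply: lrmorphism_ext => u; apply: xE.
Qed.

(** Points of X are determined by their images in the stages, so naturality,
    equivariance and uniqueness of the induced map can be checked there. *)
Lemma stage_limit : is_limit stage_transition stage_proj.
Proof.
split; first exact: stage_cone.
move=> Y q qC.
pose u (R : comAlgType k) (y : Y R) : X R := sval (cid (cone_point qC y)).
have uE R (y : Y R) i : stage_proj i R (u R y) = q i R y.
  by rewrite /u; case: cid.
have u_nat (R T : comAlgType k) (f : {lrmorphism R -> T}) (y : Y R) :
    Defs.pmap f (u R y) = u T (Defs.pmap f y).
  apply: stage_proj_joint_inj => i.
  by rewrite -gmor_nat !uE gmor_nat.
have u_act (R : comAlgType k) (y : Y R) (g : gpts G R) :
    u R (gact Y R y g) = gact X R (u R y) g.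
  by apply: stage_proj_joint_inj => i; rewrite uE !gmor_act uE.
exists (GMorph u_nat u_act); split=> [i R y|v vE R y]; first exact: uE.
by apply: stage_proj_joint_inj => i; rewrite vE uE.
Qed.

Lemma stage_fg (i : I) :
  is_torsor (oact X) -> finitely_generated (oring (stage i)).
Proof.
move=> hX.
have [s sE] := invariants_fg hX (svalP i).
exact: generated_finitely_generated sE.
Qed.

End Limit.

Theorem proposition2p3 (k : fieldType) (G : affGroup k) (X : affSpace G)
  (hX : is_torsor (oact X)) :
  exists (I : directedSet) (X_ : I -> affSpace G)
         (t : transition (fun i : I => gspace_of_aff (X_ i)))
         (p : forall i : I, gmorph X (X_ i)),
    is_limit t p /\
    forall i : I,
      finitely_generated (oring (X_ i)) /\
      torsor_mod_centralizer (X_ i).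
Proof.
exists (hopf_directedSet G), (@stage k G X), (stage_transition X), (@stage_proj k G X).
split=> [|i]; first exact: stage_limit.
by split; [exact: stage_fg|exact: quotient_torsor_mod_centralizer].
Qed.
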